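(* There is a universal constant $c>0$ such that the following holds. Let $(\mathcal X,Q,\pi)$ be an irreducible reversible finite Markov chain with generator $L$ and let $D>0$. If $\mathrm{Ric}(\mathcal X,Q,\pi)\ge0$ (non-negative entropic Ricci curvature) and the diameter of $(\mathcal X,d_{\mathcal W})$ is bounded by $D$, then the spectral gap of $L$ satisfies $$\lambda_1\ \ge\ \frac{c}{D^2}.$$
   Context: Setting. $\mathcal X$ is a finite set with at least two points and $Q:\mathcal X\times\mathcal X\to[0,\infty)$ is a collection of transition rates with $Q(x,x)=0$, irreducible: any $x,y$ are joined by a sequence $x=x_1,\dots,x_n=y$ with $Q(x_i,x_{i+1})>0$. The generator is $L\psi(x)=\sum_{y}(\psi(y)-\psi(x))Q(x,y)$ for $\psi:\mathcal X\to\mathbb R$. $\pi$ is the unique (strictly positive) stationary probability measure, assumed reversible: $Q(x,y)\pi(x)=Q(y,x)\pi(y)$ for all $x,y$. Transport distance. $\mathcal P(\mathcal X)=\{\rho:\mathcal X\to[0,\infty): \sum_x\rho(x)\pi(x)=1\}$ is the set of probability densities. Let $\theta(s,t)=\int_0^1 s^{1-p}t^p\,dp$ (logarithmic mean) and $\hat\rho(x,y)=\theta(\rho(x),\rho(y))$. For $\rho_0,\rho_1\in\mathcal P(\mathcal X)$, $$\mathcal W(\rho_0,\rho_1)^2=\inf\Big\{\tfrac12\int_0^1\sum_{x,y}(\psi_t(x)-\psi_t(y))^2\hat\rho_t(x,y)Q(x,y)\pi(x)\,dt\Big\},$$ the infimum being over absolutely continuous curves $\rho:[0,1]\to\mathcal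 P(\mathcal X)$ with endpoints $\rho_0,\rho_1$ and measurable $\psi:[0,1]\to\mathbb R^{\mathcal X}$ such that for a.e. $t$ and all $x$: $\frac{d}{dt}\rho_t(x)+\sum_y(\psi_t(y)-\psi_t(x))\hat\rho_t(x,y)Q(x,y)=0$. $\mathcal W$ is a metric on $\mathcal P(\mathcal X)$. On $\mathcal X$ one sets $d_{\mathcal W}(x,y)=\mathcal W(\delta_x,\delta_y)$, where $\delta_x$ is identified with the density $\mathbf 1_{\{x\}}/\pi(x)$. Curvature. Let $\mathcal H(\rho)=\sum_x\pi(x)\rho(x)\log\rho(x)$ (with $0\log0=0$). A constant speed geodesic is a curve $(\rho_t)_{t\in[0,1]}$ with $\mathcal W(\rho_s,\rho_t)=|s-t|\mathcal W(\rho_0,\rho_1)$. For $\kappa\in\mathbb R$, $\mathrm{Ric}(\mathcal X,Q,\pi)\ge\kappa$ means that for every constant speed geodesic $(\rho_t)$ in $(\mathcal P(\mathcal X),\mathcal W)$ and $t\in[0,1]$: $\mathcal H(\rho_t)\le(1-t)\mathcal H(\rho_0)+t\mathcal H(\rho_1)-\frac\kappa2t(1-t)\mathcal W(\rho_0,\rho_1)^2$. Spectral gap: $\lambda_1$ is the smallest non-zero eigenvalue of $-L$. ''Universal'' means independent of $\mathcal X,Q,\pi,D$. *)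

(* Defs.v *)
From HB Require Import structures.
From mathcomp Require Export all_boot all_order all_algebra.
From mathcomp Require Export all_classical all_reals all_analysis.
Set Implicit Arguments.
Unset Strict Implicit.
Unset Printing Implicit Defensive.
Export Order.TTheory GRing.Theory Num.Theory numFieldNormedType.Exports.

#[global] Open Scope classical_set_scope.
#[global] Open Scope ring_scope.

Record reversible_chain (R : realType) (X : finType)
    (Q : X -> X -> R) (pi : X -> R) : Prop := ReversibleChain {
  chain_card : (1 < #|X|)%N ;
  rate_ge0 : forall x y, 0 <= Q x y ;
  rate_diag : forall x, Q x x = 0 ;
  rate_irreducible : forall x y, connect (fun u v => 0 < Q u v) x y ;
  pi_gt0 : forall x, 0 < pi x ;
  pi_sum1 : \sum_x pi x = 1 ;
  pi_stationary : forall y, \sum_x pi x * Q x y = pi y * \sum_z Q y z ;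
  pi_reversible : forall x y, Q x y * pi x = Q y x * pi y
}.

(* The codomain is R^o, not R, because the library's vector space structure on
   {ffun X -> V} asks V to be a vector space. *)
Definition generator (R : realType) (X : finType) (Q : X -> X -> R)
    (psi : {ffun X -> R^o}) : {ffun X -> R^o} :=
  [ffun x => \sum_y (psi y - psi x) * Q x y].

Lemma generator_is_linear (R : realType) (X : finType) (Q : X -> X -> R) :
  linear (generator Q).
Proof.
move=> a f g; apply/ffunP => x; rewrite !ffunE /GRing.scale/= mulr_sumr.
rewrite -big_split/=; apply: eq_bigr => y _; rewrite !ffunE /GRing.scale/=.
by rewrite mulrA -mulrDl mulrBr opprD addrACA.
Qed.

HB.instance Definition _ (R : realType) (X : finType) (Q : X -> X -> R) :=
  GRing.isLinear.Build R {ffun X -> R^o} {ffun X -> R^o} *:%R (generator Q)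
    (generator_is_linear Q).

Definition is_spectral_gap (R : realType) (X : finType) (Q : X -> X -> R)
    (l : R) : Prop :=
  [/\ passmx.leigenvalue (- linfun (generator Q)) l,
      l != 0 &
      forall m : R, passmx.leigenvalue (- linfun (generator Q)) m -> m != 0 -> l <= m].

Definition density (R : realType) (X : finType) (pi rho : X -> R) : Prop :=
  (forall x, 0 <= rho x) /\ \sum_x rho x * pi x = 1.

(* When s = 0 or t = 0 the convention 0 `^ 0 = 1 only affects the endpoints of
   the integration interval. *)
Definition logmean (R : realType) (s t : R) : R :=
  \int[@lebesgue_measure R]_(p in `[0, 1]) (s `^ (1 - p) * t `^ p).

Definition abs_continuous01 (R : realType) (f : R -> R) : Prop :=
  forall e : R, 0 < e -> exists2 d : R, 0 < d &
    forall (n : nat) (u v : 'I_n -> R),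
      (forall i, [/\ 0 <= u i, u i < v i & v i <= 1]) ->
      trivIset [set: 'I_n] (fun i => `]u i, v i[%classic) ->
      \sum_(i < n) (v i - u i) < d ->
      \sum_(i < n) `|f (v i) - f (u i)| < e.

(* Only the values of rho and psi at times in [0, 1] matter. *)
Definition admissible (R : realType) (X : finType) (Q : X -> X -> R)
    (pi rho0 rho1 : X -> R) (rho psi : R -> X -> R) : Prop :=
  [/\ forall t : R, 0 <= t <= 1 -> density pi (rho t),
      forall x, abs_continuous01 (fun t => rho t x),
      rho 0 = rho0 /\ rho 1 = rho1,
      forall x, measurable_fun (`[0, 1] : set R) (fun t : R => psi t x) &
      {ae @lebesgue_measure R, forall t : R, 0 <= t <= 1 -> forall x,
        is_derive t 1 (fun s : R => rho s x)
          (- \sum_y (psi t y - psi t x) * logmean (rho t x) (rho t y) * Q x y)}].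

Definition action (R : realType) (X : finType) (Q : X -> X -> R)
    (pi : X -> R) (rho psi : R -> X -> R) : \bar R :=
  (2^-1%:E * \int[@lebesgue_measure R]_(t in `[0%R, 1%R])
    (\sum_x \sum_y (psi t x - psi t y) ^+ 2 *
       logmean (rho t x) (rho t y) * Q x y * pi x)%:E)%E.

(* Extended-real valued: the infimum is +oo when no admissible pair has finite
   action. *)
Definition transport_dist (R : realType) (X : finType) (Q : X -> X -> R)
    (pi rho0 rho1 : X -> R) : \bar R :=
  sqrte (ereal_inf [set a | exists rho psi : R -> X -> R,
    admissible Q pi rho0 rho1 rho psi /\ a = action Q pi rho psi]).

Definition dirac_density (R : realType) (X : finType) (pi : X -> R) (x : X) :
  X -> R := fun z => (z == x)%:R / pi x.

Definition point_dist (R : realType) (X : finType) (Q : X -> X -> R)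
    (pi : X -> R) (x y : X) : \bar R :=
  transport_dist Q pi (dirac_density pi x) (dirac_density pi y).

Definition diameter (R : realType) (X : finType) (Q : X -> X -> R)
    (pi : X -> R) : \bar R :=
  ereal_sup [set point_dist Q pi xy.1 xy.2 | xy in [set: X * X]].

(* The library's ln is 0 at 0. *)
Definition entropy (R : realType) (X : finType) (pi rho : X -> R) : R :=
  \sum_x pi x * rho x * ln (rho x).

Definition geodesic (R : realType) (X : finType) (Q : X -> X -> R)
    (pi : X -> R) (rho : R -> X -> R) : Prop :=
  (forall t : R, 0 <= t <= 1 -> density pi (rho t)) /\
  (forall s t : R, 0 <= s <= 1 -> 0 <= t <= 1 ->
    transport_dist Q pi (rho s) (rho t) =
      (`|s - t|%:E * transport_dist Q pi (rho 0%R) (rho 1%R))%E).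

Definition Ric_ge (R : realType) (X : finType) (Q : X -> X -> R)
    (pi : X -> R) (kappa : R) : Prop :=
  forall rho : R -> X -> R, geodesic Q pi rho ->
  forall t : R, 0 <= t <= 1 ->
    ((entropy pi (rho t))%:E <=
      ((1 - t) * entropy pi (rho 0) + t * entropy pi (rho 1))%:E
      - (kappa / 2 * t * (1 - t))%:E
        * (transport_dist Q pi (rho 0%R) (rho 1%R)) ^+ 2)%E.

(* Main.v *)
Require Import Defs.
From mathcomp Require Import ring lra measurable_realfun.
Set Implicit Arguments.
Unset Strict Implicit.
Unset Printing Implicit Defensive.

(** Write [H] for the entropy and [I] for the Fisher information relative to
    [pi], and [W] for the transport distance. The entropy vanishes at the
    uniform density and, by the curvature assumption, is convex along
    geodesics. Hence along a geodesic from a positive density [r] to the uniform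
    one it must start with slope at most [- H r], while the slope of [H] at [r]
    is at least [- sqrt (I r)] times the speed of the geodesic. As [W] is
    bounded by a multiple of [D] on all densities, this yields
    [H r <= C D sqrt (I r)], stated in [entropy_le_fisher] with the square root
    linearised.

    Let [psi] be an eigenfunction for [l], scaled so that its largest absolute
    value is [1] and is attained as [psi x0 = 1]. For the Gibbs density
    proportional to [exp (b psi)], with normalisation [Z b], the Fisher
    information is at most [b l], and the entropy is [b^2] times the derivative
    of [ln (Z b) / b]. So this quotient grows at speed at most
    [C D sqrt l b^(-3/2)], which is integrable at infinity. It is small for
    small [b], because [psi] has mean zero, and tends to [max psi = 1];
    therefore [1 <= C' D sqrt l]. This is [eigenvalue_ge].

    What remains is the geometry of [W]. Its square is jointly convex
    ([cost_le_convex]): averaging curves averages densities and fluxes, the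
    logarithmic mean is concave, and a potential driving the average flux is
    found by solving a weighted graph Laplace equation measurably in time.
    Coupling two densities then bounds [W^2] by [D^2] times their distance in
    total variation ([dist_tv]). So [W] is bounded and continuous for pointwise
    convergence, and pointwise limits, along an ultrafilter, of curves of almost
    minimal action are geodesics ([exists_geodesic]).

    Curves are only absolutely continuous, so their increments are estimated
    through [abs_continuous01_le_integral]. The slope inequality asks no more
    than that: by convexity of [x ln x], the loss of entropy along a curve
    leaving [r] is at most that of the linear functional
    [sum_x pi x ln (r x) rho x]. *)

(** * The logarithmic mean *)

Lemma lebesgue01 (R : realType) : @lebesgue_measure R `[0, 1]%classic = 1%E.
Proof. by rewrite lebesgue_measure_itv/= lte_fin ltr01 oppr0 adde0. Qed.

Lemma lebesgue01_lty (R : realType) :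
  (@lebesgue_measure R `[0%R, 1%R]%classic < +oo)%E.
Proof. by rewrite lebesgue01 ltry. Qed.

Lemma Rintegral01_cst (R : realType) (c : R) :
  \int[@lebesgue_measure R]_(p in `[0, 1]) c = c.
Proof.
rewrite /Rintegral -[X in integral _ _ X]/(cst c%:E) integral_cst//.
transitivity (fine (c%:E * 1)%E); last by rewrite mule1.
by congr (fine (_ * _)%E); exact: lebesgue01.
Qed.

Section LogMean.
Context {R : realType}.
Implicit Types (s t p a : R).

Let lm (s t p : R) : R := s `^ (1 - p) * t `^ p.

Let lm_ge0 s t p : 0 <= lm s t p.
Proof. by rewrite mulr_ge0 ?powR_ge0. Qed.

Let in01 p : (`[0, 1]%classic : set R) p -> 0 <= p <= 1.
Proof. by rewrite /= in_itv. Qed.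

(** Both arguments are compared with their weighted mean through the tangent of
    the logarithm. *)
Lemma powR_young s t p : 0 <= s -> 0 <= t -> 0 <= p <= 1 ->
  s `^ (1 - p) * t `^ p <= (1 - p) * s + p * t.
Proof.
move=> s0 t0 /andP[p0 p1].
have [->|p0'] := eqVneq p 0.
  by rewrite subr0 powRr1// powRr0 mulr1 mul1r mul0r addr0.
have [->|p1'] := eqVneq p 1.
  by rewrite subrr powRr0 powRr1// !mul1r mul0r add0r.
have [->|sn0] := eqVneq s 0.
  rewrite powR0 ?mul0r ?mulr0 ?add0r ?mulr_ge0//.
  by rewrite subr_eq0 eq_sym.
have [->|tn0] := eqVneq t 0.
  by rewrite powR0// mulr0 mulr0 addr0 mulr_ge0// subr_ge0.
have {}s0 : 0 < s by rewrite lt_def sn0.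
have {}t0 : 0 < t by rewrite lt_def tn0.
set m := (1 - p) * s + p * t.
have m0 : 0 < m.
  have : 0 < p by rewrite lt_def p0'.
  have : 0 < 1 - p by rewrite subr_gt0 lt_def eq_sym p1'.
  by move=> ? ?; rewrite /m addr_gt0// mulr_gt0.
have lnle x : 0 < x -> ln x <= ln m + (x / m - 1).
  move=> x0; have xm : 0 < x / m by rewrite divr_gt0.
  have -> : x = m * (x / m) by rewrite mulrC divfK// gt_eqF.
  rewrite lnM ?posrE// lerD2l [m * _]mulrC divfK ?gt_eqF//.
  by rewrite -{1}(subrKC 1 (x / m)) le_ln1Dx//; lra.
rewrite /powR !gt_eqF// -expRD -[leRHS](lnK m0) ler_expR.
apply: (@le_trans _ _ ((1 - p) * (ln m + (s / m - 1)) + p * (ln m + (t / m - 1)))).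
  by rewrite lerD// ler_wpM2l ?subr_ge0// lnle.
rewrite le_eqVlt; apply/orP; left; apply/eqP.
have -> : (1 - p) * (ln m + (s / m - 1)) + p * (ln m + (t / m - 1)) =
  ln m + (m / m - 1) by rewrite /m; ring.
by rewrite divff ?gt_eqF// subrr addr0.
Qed.

Let lmZ a s t p : 0 <= a -> 0 <= s -> 0 <= t ->
  lm (a * s) (a * t) p = a * lm s t p.
Proof.
move=> a0 s0 t0; rewrite /lm !powRM//.
have -> : a * (s `^ (1 - p) * t `^ p) = (a `^ (1 - p) * a `^ p) * (s `^ (1 - p) * t `^ p).
  congr (_ * _); rewrite -powRD ?subrK ?powRr1//.
  by rewrite oner_eq0.
by ring.
Qed.

Let lm_superadditive s t s' t' p : 0 <= s -> 0 <= t -> 0 <= s' -> 0 <= t' ->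
  0 <= p <= 1 -> lm s t p + lm s' t' p <= lm (s + s') (t + t') p.
Proof.
move=> s0 t0 s0' t0' p01.
have [p0|pn0] := eqVneq p 0.
  by rewrite /lm p0 subr0 !powRr1 ?addr_ge0// !powRr0 !mulr1.
have [p1|pn1] := eqVneq p 1.
  by rewrite /lm p1 subrr !powRr1 ?addr_ge0// !powRr0 !mul1r.
have lm0l x : lm 0 x p = 0.
  by rewrite /lm powR0 ?mul0r// subr_eq0 eq_sym.
have lm0r x : lm x 0 p = 0 by rewrite /lm powR0 ?mulr0.
have [/eqP S0|Sn0] := eqVneq (s + s') 0.
  by move: S0; rewrite paddr_eq0// => /andP[/eqP-> /eqP->]; rewrite !lm0l !addr0 lm_ge0.
have [/eqP T0|Tn0] := eqVneq (t + t') 0.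
  by move: T0; rewrite paddr_eq0// => /andP[/eqP-> /eqP->]; rewrite !lm0r !addr0 lm_ge0.
move: (Sn0) (Tn0); set S := s + s'; set T := t + t' => Sn0' Tn0'.
have SS : 0 < S by rewrite lt_def Sn0 addr_ge0.
have TT : 0 < T by rewrite lt_def Tn0 addr_ge0.
have lmE x y : 0 <= x -> 0 <= y -> lm x y p <= lm S T p * ((1 - p) * (x / S) + p * (y / T)).
  move=> x0 y0; have -> : lm x y p = lm S T p * lm (x / S) (y / T) p.
    rewrite /lm mulrACA -!powRM ?divr_ge0 ?(ltW SS) ?(ltW TT)//.
    by rewrite [S * _]mulrC [T * _]mulrC !divfK ?gt_eqF.
  by rewrite ler_wpM2l ?lm_ge0// powR_young// divr_ge0// ltW.
apply: (le_trans (lerD (lmE _ _ s0 t0) (lmE _ _ s0' t0'))).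
rewrite -mulrDr -[leRHS]mulr1 ler_wpM2l ?lm_ge0//.
rewrite le_eqVlt; apply/orP; left; apply/eqP.
have -> : (1 - p) * (s / S) + p * (t / T) + ((1 - p) * (s' / S) + p * (t' / T)) =
  (1 - p) * (S / S) + p * (T / T) by rewrite /S /T; ring.
by rewrite !divff// !mulr1 subrK.
Qed.

Let lm_integrable s t : 0 <= s -> 0 <= t ->
  (@lebesgue_measure R).-integrable `[0, 1] (EFin \o lm s t).
Proof.
move=> s0 t0; apply: measurable_bounded_integrable => //.
- exact: lebesgue01_lty.
- apply: measurable_funTS; apply: measurable_funM.
    apply: (measurableT_comp (measurable_powRr s)).
    exact: measurable_funB.
  exact: measurable_powRr.
- exists (s + t); split; first by rewrite num_real.
  move=> x stx p /in01 p01 /=; rewrite ger0_norm ?lm_ge0// (le_trans _ (ltW stx))//.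
  rewrite (le_trans (powR_young s0 t0 p01))//.
  case/andP: p01 => p0 p1; nra.
Qed.

Lemma logmean_ge0 s t : 0 <= logmean s t.
Proof. by apply: Rintegral_ge0 => p _; exact: lm_ge0. Qed.

Lemma logmeanZ a s t : 0 <= a -> 0 <= s -> 0 <= t ->
  logmean (a * s) (a * t) = a * logmean s t.
Proof.
move=> a0 s0 t0; rewrite /logmean -RintegralZl//; last exact: lm_integrable.
by apply: eq_Rintegral => p _; exact: lmZ.
Qed.


Let logmeanD s t s' t' : 0 <= s -> 0 <= t -> 0 <= s' -> 0 <= t' ->
  logmean s t + logmean s' t' <= logmean (s + s') (t + t').
Proof.
move=> s0 t0 s0' t0'; rewrite /logmean -RintegralD//; try exact: lm_integrable.
apply: le_Rintegral => //.
- rewrite [X in _.-integrable _ X](_ : _ =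
    (fun x => (EFin \o lm s t) x + (EFin \o lm s' t') x)%E)//.
  by apply: integrableD => //; exact: lm_integrable.
- by apply: lm_integrable; rewrite addr_ge0.
- by move=> p /in01 p01; exact: lm_superadditive.
Qed.

(** Together with homogeneity this is the joint concavity of the logarithmic
    mean, inherited from the weighted geometric means under the integral sign. *)
Lemma logmean_superadditive (I : finType) (s t : I -> R) :
  (forall i, 0 <= s i) -> (forall i, 0 <= t i) ->
  \sum_i logmean (s i) (t i) <= logmean (\sum_i s i) (\sum_i t i).
Proof.
move=> s0 t0; elim: (index_enum I) => [|i r IH].
  by rewrite !big_nil logmean_ge0.
rewrite !big_cons; apply: le_trans (logmeanD _ _ _ _); rewrite ?sumr_ge0//.
by rewrite lerD2l.
Qed.

Lemma ler_logmean s t s' t' : 0 <= s <= s' -> 0 <= t <= t' ->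
  logmean s t <= logmean s' t'.
Proof.
move=> /andP[s0 ss'] /andP[t0 tt'].
rewrite -(subrKC s s') -(subrKC t t').
by apply: le_trans (logmeanD _ _ _ _) => //; rewrite ?subr_ge0// lerDl logmean_ge0.
Qed.

Lemma logmean_le_add s t : 0 <= s -> 0 <= t -> logmean s t <= s + t.
Proof.
move=> s0 t0.
rewrite -[leRHS](Rintegral01_cst (s + t)).
apply: le_Rintegral => //; first exact: lm_integrable.
  apply: measurable_bounded_integrable => //.
    exact: lebesgue01_lty.
  by exists `|s + t|; split => // x /ltW xst p _.
move=> p /in01 p01; rewrite (le_trans (powR_young s0 t0 p01))//=.
by case/andP: p01 => p0 p1; nra.
Qed.

(** The integrand is the derivative of itself up to the factor
    [ln t - ln s], hence the closed form of the logarithmic mean. *)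
Lemma logmean_ln s t : 0 < s -> 0 < t -> logmean s t * (ln t - ln s) = t - s.
Proof.
move=> s0 t0.
pose F p := expR ((1 - p) * ln s + p * ln t).
have FE p : lm s t p = F p by rewrite /lm /powR !gt_eqF// -expRD.
have dF (p : R) : is_derive p 1 F (F p * (ln t - ln s)).
  rewrite /F; apply: is_derive_eq; rewrite /GRing.scale/=; ring.
have cF : continuous F.
  by move=> p; apply/differentiable_continuous/derivable1_diffP; case: (dF p).
pose f p := (ln t - ln s) * F p.
have -> : logmean s t * (ln t - ln s) = \int[@lebesgue_measure R]_(p in `[0, 1]) f p.
  rewrite mulrC /logmean -RintegralZl//; last by apply: lm_integrable; exact: ltW.
  by apply: eq_Rintegral => p _; rewrite /f -FE.
rewrite /Rintegral (@continuous_FTC2 _ f F)//.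
- by rewrite /F !subrr !subr0 !mul1r !mul0r add0r addr0 !lnK.
- apply: continuous_subspaceT => p.
  by apply: (@continuousM _ _ (cst (ln t - ln s)) F); [exact: cvg_cst|exact: cF].
- split => //.
  + by apply: cvg_at_right_filter; exact: cF.
  + by apply: cvg_at_left_filter; exact: cF.
- by move=> p _; rewrite derive1E (derive_val (f := F)) /f mulrC.
Qed.

Lemma logmeanxx t : 0 <= t -> logmean t t = t.
Proof.
move=> t0; rewrite -[RHS](Rintegral01_cst t); apply: eq_Rintegral.
move=> p _; rewrite -powRD ?subrK ?powRr1//.
by rewrite oner_eq0.
Qed.

Lemma logmean0l t : 0 <= t -> logmean 0 t = 0.
Proof.
move=> t0; rewrite /logmean -Rintegral_itv_bndo_bndc; last first.
  apply: (integrableS _ _ _ (lm_integrable (lexx 0) t0)) => //.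
  by apply: subset_itvl; rewrite bnd_simp.
rewrite (@eq_Rintegral _ _ _ _ _ (cst 0)).
  by rewrite /Rintegral integral0.
move=> p; rewrite inE/= in_itv/= => /andP[_ p1].
by rewrite powR0 ?mul0r// subr_eq0 gt_eqF.
Qed.

Let logmean0r s : 0 <= s -> logmean s 0 = 0.
Proof.
move=> s0; rewrite /logmean -Rintegral_itv_obnd_cbnd; last first.
  apply: (integrableS _ _ _ (lm_integrable s0 (lexx 0))) => //.
  by apply: subset_itvr; rewrite bnd_simp.
rewrite (@eq_Rintegral _ _ _ _ _ (cst 0)).
  by rewrite /Rintegral integral0.
move=> p; rewrite inE/= in_itv/= => /andP[p0 _].
by rewrite [0 `^ p]powR0 ?mulr0// gt_eqF.
Qed.

Lemma logmeanC s t : 0 <= s -> 0 <= t -> logmean s t = logmean t s.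
Proof.
rewrite le_eqVlt => /predU1P[<- t0|s0]; first by rewrite logmean0l ?logmean0r.
rewrite le_eqVlt => /predU1P[<-|t0].
  by rewrite logmean0l ?logmean0r// ltW.
have [->//|st] := eqVneq s t.
have lnst : ln t - ln s != 0.
  by rewrite subr_eq0; apply: contra st => /eqP/esym/ln_inj ->.
apply: (mulIf lnst); rewrite (logmean_ln s0 t0) -(opprB (ln s)) mulrN (logmean_ln t0 s0).
by rewrite opprB.
Qed.

End LogMean.

(** Writing the inverse as [x * (x^2)^(-1)] reduces it to a real power of a
    nonnegative number. *)
Lemma measurable_inv (R : realType) d (T : measurableType d) (D : set T) (f : T -> R) :
  measurable_fun D f -> measurable_fun D (fun x => (f x)^-1).
Proof.
move=> mf.
have -> : (fun x => (f x)^-1) = (fun x => f x * (f x ^+ 2) `^ (-1)).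
  apply/funext => x; rewrite powR_inv1 ?sqr_ge0//.
  have [->|fx0] := eqVneq (f x) 0; first by rewrite invr0 mul0r.
  by rewrite expr2 invfM mulrA divff// mul1r.
apply: measurable_funM => //.
by apply: (measurableT_comp (@measurable_powR R (-1))); exact: measurable_funX.
Qed.

Lemma measurable_logmean (R : realType) d (T : measurableType d) (D : set T) (f g : T -> R) :
  measurable D -> measurable_fun D f -> measurable_fun D g ->
  (forall x, D x -> 0 <= f x) -> (forall x, D x -> 0 <= g x) ->
  measurable_fun D (fun x => logmean (f x) (g x)).
Proof.
move=> mD mf mg f0 g0.
pose h x := if 0 < f x * g x then
   (if f x == g x then f x else (g x - f x) * (ln (g x) - ln (f x))^-1) else 0.
apply: (@eq_measurable_fun _ _ _ _ _ h).
  move=> x; rewrite inE => Dx; rewrite /h.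
  have := f0 x Dx; rewrite le_eqVlt => /predU1P[<-|fx0].
    by rewrite mul0r ltxx logmean0l ?g0.
  have := g0 x Dx; rewrite le_eqVlt => /predU1P[<-|gx0].
    by rewrite mulr0 ltxx logmeanC// ?f0// logmean0l ?f0.
  rewrite mulr_gt0//; have [->|fg] := eqVneq (f x) (g x); first by rewrite logmeanxx// ltW.
  rewrite -logmean_ln// mulfK// subr_eq0; by apply: contra fg => /eqP/esym/ln_inj ->.
apply: measurable_fun_if => //.
  by apply: measurable_fun_ltr => //; exact: measurable_funM.
apply: (measurable_funS mD); first by move=> ? [].
apply: measurable_fun_if => //.
- exact: measurable_fun_eqr.
- by apply: (measurable_funS mD) => // ? [].
apply: (measurable_funS mD); first by move=> ? [].
apply: measurable_funM; first exact: measurable_funB.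
by apply: measurable_inv; apply: measurable_funB;
  apply: (measurableT_comp (@measurable_ln R)).
Qed.

(** * Absolutely continuous functions *)

(** Degenerate intervals and arbitrary finite index types are harmless; this
    form is stable under disjoint unions of families and monotone images. *)
Lemma abs_continuous01P (R : realType) (f : R -> R) : abs_continuous01 f ->
  forall e : R, 0 < e -> exists2 d : R, 0 < d &
    forall (I : finType) (u v : I -> R),
      (forall i, [/\ 0 <= u i, u i <= v i & v i <= 1]) ->
      trivIset [set: I] (fun i => `]u i, v i[%classic) ->
      \sum_i (v i - u i) < d -> \sum_i `|f (v i) - f (u i)| < e.
Proof.
move=> acf e /acf[d d0 fd]; exists d => // I u v uv tuv suv.
pose A := [pred i | u i < v i].
have sumA (F : I -> R) : (forall i, u i = v i -> F i = 0) ->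
    \sum_i F i = \sum_(k < #|A|) F (enum_val k).
  move=> F0; rewrite -big_enum_val/= [LHS](bigID (mem A))/=.
  rewrite [X in _ + X]big1 ?addr0// => i; rewrite inE -leNgt => vu.
  by apply/F0/eqP; rewrite eq_le vu; case: (uv i) => _ ->.
rewrite sumA; last by move=> i ->; rewrite subrr normr0.
apply: fd.
- move=> k; have [u0 _ v1] := uv (enum_val k); split => //.
  exact: (enum_valP k).
- by move=> j k _ _ jk; apply/enum_val_inj/tuv.
- by rewrite -(sumA (fun i => v i - u i))// => i ->; rewrite subrr.
Qed.

Lemma abs_continuous01_cst (R : realType) (c : R) : abs_continuous01 (fun=> c).
Proof.
by move=> e e0; exists 1 => // n u v _ _ _; rewrite big1// => i _; rewrite subrr normr0.
Qed.

Lemma abs_continuous01D (R : realType) (f g : R -> R) :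
  abs_continuous01 f -> abs_continuous01 g -> abs_continuous01 (fun t => f t + g t).
Proof.
move=> acf acg e e0; have e20 : 0 < e / 2 by rewrite divr_gt0.
have [d d0 fd] := acf _ e20; have [d' d'0 gd] := acg _ e20.
exists (Num.min d d'); first by rewrite lt_min d0.
move=> n u v uv tuv; rewrite lt_min => /andP[sd sd'].
apply: le_lt_trans (_ : _ <= \sum_(i < n) `|f (v i) - f (u i)| +
                            \sum_(i < n) `|g (v i) - g (u i)|) _.
  rewrite -big_split/=; apply: ler_sum => i _.
  by rewrite opprD addrACA ler_normD.
by rewrite [e]splitr ltrD// ?fd// gd.
Qed.

Lemma abs_continuous01Z (R : realType) (a : R) (f : R -> R) :
  abs_continuous01 f -> abs_continuous01 (fun t => a * f t).
Proof.
move=> acf e e0; have a0 : 0 < `|a| + 1 by rewrite ltr_wpDl.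
have [d d0 fd] := acf _ (divr_gt0 e0 a0); exists d => // n u v uv tuv suv.
apply: le_lt_trans (_ : _ <= (`|a| + 1) * \sum_(i < n) `|f (v i) - f (u i)|) _.
  rewrite mulr_sumr; apply: ler_sum => i _.
  by rewrite -mulrBr normrM ler_wpM2r// lerDl.
by rewrite mulrC -ltr_pdivlMr// fd.
Qed.

Lemma abs_continuous01_sum (R : realType) (I : finType) (f : I -> R -> R) :
  (forall i, abs_continuous01 (f i)) -> abs_continuous01 (fun t => \sum_i f i t).
Proof.
move=> acf; elim: (index_enum I) => [|i r IH].
  rewrite (_ : (fun _ => _) = fun=> 0) //; first exact: abs_continuous01_cst.
  by apply/funext => t; rewrite big_nil.
rewrite (_ : (fun _ => _) = fun t => f i t + \sum_(j <- r) f j t).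
  exact: abs_continuous01D (acf i) IH.
by apply/funext => t; rewrite big_cons.
Qed.

(** Composition with a monotone Lipschitz change of time: monotonicity keeps
    disjoint intervals disjoint. *)
Lemma abs_continuous01_comp (R : realType) (f phi : R -> R) (k : R) :
  abs_continuous01 f ->
  (forall t, 0 <= t <= 1 -> 0 <= phi t <= 1) ->
  (forall s t, s <= t -> `|phi t - phi s| <= k * (t - s)) ->
  {homo phi : s t / s <= t} \/ {homo phi : s t /~ s <= t} ->
  abs_continuous01 (f \o phi).
Proof.
move=> acf phi01 phik mphi e e0.
have [d d0 fd] := abs_continuous01P acf e0.
have k0 : 0 < `|k| + 1 by rewrite ltr_wpDl.
exists (d / (`|k| + 1)) => [|n u v uv tuv suv]; first exact: divr_gt0.
pose u' i := Num.min (phi (u i)) (phi (v i)).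
pose v' i := Num.max (phi (u i)) (phi (v i)).
have uv01 i : (0 <= u i <= 1) * (0 <= v i <= 1).
  by have [u0 /ltW lt_uv v1] := uv i; rewrite u0 v1 (le_trans u0)// (le_trans lt_uv).
have sub i : v' i - u' i = `|phi (v i) - phi (u i)|.
  rewrite /u' /v'; case: leP => h; first by rewrite ger0_norm// subr_ge0.
  by rewrite ltr0_norm ?subr_lt0// opprB.
have -> : \sum_(i < n) `|(f \o phi) (v i) - (f \o phi) (u i)| =
    \sum_(i < n) `|f (v' i) - f (u' i)|.
  apply: eq_bigr => i _; rewrite /u' /v' /=; case: leP => // h.
  by rewrite distrC.
apply: fd.
- move=> i; have [/phi01/andP[? ?] /phi01/andP[? ?]] := uv01 i.
  by rewrite /u' /v' le_min ge_max; split; [apply/andP| |apply/andP] => //;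
    rewrite ge_min !le_max lexx.
- move=> i j _ _ [y [/=]]; rewrite !in_itv/= => yi yj.
  apply/eqP; apply: contraT => ij.
  have : (v i <= u j) || (v j <= u i).
    rewrite leNgt leNgt -negb_and; apply/negP => /andP[uvi uvj].
    have [_ ui _] := uv i; have [_ uj _] := uv j.
    have : i = j.
      apply: tuv => //; pose a := Num.max (u i) (u j); pose b := Num.min (v i) (v j).
      have ab : a < b by rewrite /a /b gt_max !lt_min ui uj uvi uvj.
      exists ((a + b) / 2); have [h1 h2] := (midf_lt ab).
      move: h1 h2; rewrite /a /b gt_max lt_min => /andP[? ?] /andP[? ?].
      by split; rewrite /= in_itv/=; apply/andP.
    by move/eqP; exact/negP.
  have [_ /ltW ui _] := uv i; have [_ /ltW uj _] := uv j.
  move: yi yj; rewrite /u' /v' !gt_min !lt_max => /andP[yi1 yi2] /andP[yj1 yj2].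
  case: mphi => mphi.
    have mi := mphi _ _ ui; have mj := mphi _ _ uj.
    by case/orP => /mphi h; lra.
  have mi := mphi _ _ ui; have mj := mphi _ _ uj.
  by case/orP => /mphi h; lra.
- apply: le_lt_trans (_ : (`|k| + 1) * \sum_(i < n) (v i - u i) < d).
    rewrite mulr_sumr; apply: ler_sum => i _; rewrite sub.
    have [_ /ltW ui _] := uv i; rewrite (le_trans (phik _ _ ui))// ler_wpM2r ?subr_ge0//.
    by rewrite (le_trans (ler_norm k))// lerDl.
  by rewrite mulrC -ltr_pdivlMr.
Qed.

(** The supremum of the times reached from [a] is itself reached, and would
    be exceeded if it were not [b]. *)
Lemma interval_chain (R : realType) (P : R -> R -> Prop) (a b : R) : a <= b ->
  (forall s t u, s <= t -> t <= u -> P s t -> P t u -> P s u) ->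
  (forall x, a <= x <= b -> exists2 d, 0 < d &
     forall s t, a <= s -> s <= x -> x <= t -> t <= b -> x - d < s -> t < x + d -> P s t) ->
  P a b.
Proof.
move=> ab Ptrans Ploc.
pose S := [set t | a <= t <= b /\ P a t].
have Sa : S a.
  split; first by rewrite lexx.
  have [|d d0] := Ploc a; first by rewrite lexx.
  by apply; rewrite ?lexx// ?ltrBlDr ltrDl.
have Sb : ubound S b by move=> t [/andP[]].
have hS : has_sup S by split; [exists a|exists b].
have aT : a <= sup S by apply: ub_le_sup => //; exists b.
have Tb : sup S <= b by apply: ge_sup => //; exists a.
have [|d d0 Pd] := Ploc (sup S); first by rewrite aT.
have [t [/andP[at_ tb] Pat] Tdt] := sup_adherent d0 hS.
have tT : t <= sup S by apply: ub_le_sup; [exists b|split => //; apply/andP].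
have reach z : sup S <= z -> z <= b -> z < sup S + d -> P a z.
  move=> Tz zb zd; apply: (Ptrans a t z) => //; first exact: le_trans Tz.
  exact: Pd.
have [Tb'|] := ltP (sup S) b; last first.
  by move=> bT; apply: reach => //; apply: (le_lt_trans bT); rewrite ltrDl.
pose z := Num.min b (sup S + d / 2).
have zT : sup S < z by rewrite lt_min Tb' ltrDl divr_gt0.
have : S z.
  split; first by rewrite (le_trans aT (ltW zT)) ge_min lexx.
  apply: reach; rewrite ?(ltW zT)// ?ge_min ?lexx//.
  by rewrite gt_min ltrD2l ltr_pdivrMr// ltr_pMr// ltr1n orbT.
move=> Sz; have : z <= sup S by apply: ub_le_sup => //; exists b.
by rewrite leNgt zT.
Qed.

(** Cutting at [x] reduces an interval around [x] to two intervals ending there,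
    which the difference quotients control. *)
Lemma is_derive_le0_straddle (R : realType) (f : R -> R) (x c e : R) :
  is_derive x 1 f c -> c <= 0 -> 0 < e -> exists2 d, 0 < d &
    forall s t, s <= x -> x <= t -> x - d < s -> t < x + d -> f t - f s <= e * (t - s).
Proof.
move=> [dv dE] c0 e0.
have h : (fun h => h^-1 *: (f (h *: 1 + x) - f x)) @ 0^' --> c by rewrite -dE; exact: dv.
move/cvgrPdist_lt : h => /(_ e e0) /nbhs_ballP[d /= d0 hd].
exists d => // s t sx xt ds td.
have key y : y != x -> `|y - x| < d -> (f y - f x) / (y - x) < e /\ y - x != 0.
  move=> yx yd; have yx0 : y - x != 0 by rewrite subr_eq0.
  have := hd (y - x); rewrite /ball/= sub0r normrN => /(_ yd yx0).
  rewrite /GRing.scale/= mulr1 subrK mulrC ltr_distlC => /andP[_ h1].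
  by split => //; apply: (lt_le_trans h1); lra.
have -> : f t - f s = (f t - f x) + (f x - f s) by ring.
have -> : e * (t - s) = e * (t - x) + e * (x - s) by ring.
apply: lerD.
  have [->|tx] := eqVneq t x; first by rewrite !subrr mulr0.
  have xt' : 0 < t - x by rewrite subr_gt0 lt_def tx.
  have [|h1 _] := key t tx; first by rewrite gtr0_norm//; lra.
  by rewrite -ler_pdivrMr// ltW.
have [->|sx0] := eqVneq s x; first by rewrite !subrr mulr0.
have xs' : 0 < x - s by rewrite subr_gt0 lt_def eq_sym sx0.
have [|h1 _] := key s sx0; first by rewrite distrC gtr0_norm//; lra.
by rewrite -ler_pdivrMr// ltW// -(opprB (f s)) -(opprB s) invrN mulrNN.
Qed.

Lemma itvoo_disjoint (R : realType) (a b c d y : R) : b <= c ->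
  `]a, b[%classic y -> `]c, d[%classic y -> False.
Proof. by rewrite /= !in_itv/= => bc /andP[_ yb] /andP[cy _]; lra. Qed.

Lemma lebesgue_itvoo (R : realType) (a b : R) : a <= b ->
  @lebesgue_measure R `]a, b[%classic = (b - a)%:E.
Proof.
move=> ab; rewrite lebesgue_measure_itv/= lte_fin -EFinB; case: ltP => // ba.
by congr EFin; apply/esym/eqP; rewrite subr_eq0 eq_le ab ba.
Qed.

Section Comparison.
Context {R : realType}.
Let mu : {measure set (measurableTypeR R) -> \bar R} := @lebesgue_measure R.

(** Away from a null set the increment of [f] is controlled by that of [F];
    the null set is covered by an open set so small that [f] hardly moves on
    finitely many disjoint intervals inside it. The two kinds of control are
    chained together along the segment. *)
Lemma abs_continuous01_le (f F : R -> R) : abs_continuous01 f ->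
  {homo F : s t / s <= t} ->
  {ae @lebesgue_measure R, forall t : R, 0 <= t <= 1 -> exists a b : R,
      [/\ is_derive t 1 f a, is_derive t 1 F b & a <= b]} ->
  forall r, 0 <= r <= 1 -> f r - f 0 <= F r - F 0.
Proof.
move=> acf ndF [A [mA A0 NA]] r /andP[r0 r1].
apply/ler_addgt0Pr => e e0; have e20 : 0 < e / 2 by rewrite divr_gt0.
have [d d0 fd] := abs_continuous01P acf e20.
have [U [oU AU UAd]] : exists U, [/\ open U, A `<=` U & (mu (U `\` A) < d%:E)%E].
  apply: lebesgue_regularity_outer => //; exact: (eq_ind_r (fun z => (z < +oo)%E) (ltry 0) A0).
have mU : measurable U by exact: open_measurable.
have Ud : (mu U < d%:E)%E.
  rewrite -(setDUK AU); apply: le_lt_trans (measureU2 _ _ _) _ => //.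
    exact: measurableD.
  by rewrite [X in (X + _)%E](_ : _ = 0%E)// add0e.
pose P s t := exists (I : finType) (u v : I -> R),
  [/\ forall i, [/\ s <= u i, u i <= v i & v i <= t],
      trivIset [set: I] (fun i => `]u i, v i[%classic),
      forall i, `]u i, v i[%classic `<=` U &
      f t - f s <= F t - F s + e / 2 * (t - s) + \sum_i `|f (v i) - f (u i)|].
have : P 0 r.
  apply: interval_chain => //.
    move=> s t w st tw [I [u [v [uv tuv Uuv le1]]]] [J [u' [v' [uv' tuv' Uuv' le2]]]].
    pose u2 (k : I + J) := match k with inl i => u i | inr j => u' j end.
    pose v2 (k : I + J) := match k with inl i => v i | inr j => v' j end.
    exists (I + J)%type, u2, v2; split.
    - case=> [i|j] /=; first by have [? ? ?] := uv i; split => //; lra.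
      by have [? ? ?] := uv' j; split => //; lra.
    - case=> [i|j] [i'|j'] _ _ /=.
      + by move=> h; congr inl; apply: tuv.
      + have [? ? ?] := uv i; have [? ? ?] := uv' j'; move=> [y [yi yj]].
        by case: (@itvoo_disjoint _ (u i) (v i) (u' j') (v' j') y) => //; lra.
      + have [? ? ?] := uv i'; have [? ? ?] := uv' j; move=> [y [yj yi]].
        by case: (@itvoo_disjoint _ (u i') (v i') (u' j) (v' j) y) => //; lra.
      + by move=> h; congr inr; apply: tuv'.
    - by case=> [i|j] /=.
    - by rewrite big_sumType/=; lra.
  move=> x /andP[x0 xr].
  have [Ux|nUx] := pselect (U x).
    have /nbhs_ballP[k /= k0 kU] := open_nbhs_nbhs (conj oU Ux).
    exists k => // s t s0 sx xt tr ks tk.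
    exists unit, (fun=> s), (fun=> t); split.
    - by move=> _; split => //; lra.
    - by move=> [] [].
    - move=> _ y; rewrite /= in_itv/= => /andP[sy yt]; apply: kU.
      by rewrite /ball/= ltr_norml; apply/andP; split; lra.
    - rewrite big_const card_unit/= addr0.
      have := ler_norm (f t - f s); have := ndF _ _ (le_trans sx xt).
      have : 0 <= e / 2 * (t - s) by rewrite mulr_ge0//; lra.
      lra.
  have [a [b [fa Fb ab]]] : exists a b,
      [/\ is_derive x 1 f a, is_derive x 1 F b & a <= b].
    apply: contrapT => h; apply: nUx; apply: AU; apply: NA => /= h2; apply: h.
    by apply: h2; lra.
  have dfF : is_derive x 1 (f - F) (a - b) by exact: is_deriveB.
  have [|k k0 hk] := is_derive_le0_straddle dfF _ e20; first by lra.
  exists k => // s t s0 sx xt tr ks tk.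
  exists void, (fun=> 0), (fun=> 0); split => //; try by case.
  have := hk s t sx xt ks tk.
  rewrite big1 ?addr0; last by case.
  by rewrite /= !fctE; lra.
move=> [I [u [v [uv tuv Uuv le1]]]].
suff : \sum_i `|f (v i) - f (u i)| < e / 2.
  have : e / 2 * (r - 0) <= e / 2 by rewrite subr0 ler_piMr// ltW.
  by lra.
apply: fd => //.
  by move=> i; have [? ? ?] := uv i; split => //; lra.
rewrite -lte_fin; apply: le_lt_trans Ud.
apply: (@le_trans _ _ (mu (\bigcup_(i in [set: I]) `]u i, v i[%classic))); last first.
  apply: le_measure; rewrite ?inE//; last exact: bigcup_sub.
  by apply: fin_bigcup_measurable => // i _; exact: measurable_itv.
have IE : [set: I] = [set` index_enum I].
  by apply/seteqP; split => // i _ /=; exact: mem_index_enum.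
have -> : mu (\bigcup_(i in [set: I]) `]u i, v i[%classic) =
    (\sum_(i \in [set: I]) mu `]u i, v i[%classic)%E.
  by apply: measure_fin_bigcup => //; exact: finite_finset.
rewrite IE -fsbig_seq ?index_enum_uniq// -sumEFin le_eqVlt; apply/orP; left.
apply/eqP/eq_bigr => i _; apply/esym/lebesgue_itvoo.
by have [_ uvi _] := uv i.
Qed.

End Comparison.

Section IntegralBound.
Context {R : realType}.

Lemma ae_lebesgueS2 (P Q S : R -> Prop) : (forall t, P t -> Q t -> S t) ->
  {ae @lebesgue_measure R, forall t : R, P t} ->
  {ae @lebesgue_measure R, forall t : R, Q t} ->
  {ae @lebesgue_measure R, forall t : R, S t}.
Proof.
move=> PQS [A [mA A0 PA]] [B [mB B0 QB]]; exists (A `|` B); split.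
- exact: measurableU.
- exact: (etrans (measureU0 mA mB B0) A0).
- move=> t /= St; apply: contrapT => /not_orP[nA nB]; apply: St; apply: PQS.
    by apply: contrapT => /PA.
  by apply: contrapT => /QB.
Qed.

Lemma ae_lebesgueI (P Q : R -> Prop) :
  {ae @lebesgue_measure R, forall t : R, P t} ->
  {ae @lebesgue_measure R, forall t : R, Q t} ->
  {ae @lebesgue_measure R, forall t : R, P t /\ Q t}.
Proof. by move=> hP hQ; apply: (ae_lebesgueS2 _ hP hQ). Qed.

Lemma ae_lebesgueS (P Q : R -> Prop) : (forall t, P t -> Q t) ->
  {ae @lebesgue_measure R, forall t : R, P t} ->
  {ae @lebesgue_measure R, forall t : R, Q t}.
Proof. by move=> PQ Pae; apply: (ae_lebesgueS2 _ Pae Pae) => t /PQ. Qed.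

(** By Lebesgue differentiation the indefinite integral of [g] is a monotone
    function with derivative [g] almost everywhere. *)
Lemma abs_continuous01_le_integral (f g : R -> R) : abs_continuous01 f ->
  (@lebesgue_measure R).-integrable `[0, 1] (EFin \o g) ->
  (forall t, 0 <= t <= 1 -> 0 <= g t) ->
  {ae @lebesgue_measure R, forall t : R, 0 <= t <= 1 ->
     exists2 a : R, is_derive t 1 f a & a <= g t} ->
  forall r, 0 <= r <= 1 ->
  f r - f 0 <= \int[@lebesgue_measure R]_(t in `[0, 1]) g t.
Proof.
move=> acf ig g0 fae r r01.
pose h := g \_ `[0, 1].
have h0 x : 0 <= h x.
  by rewrite /h patchE; case: ifPn => //; rewrite inE/= in_itv/= => /g0.
have ih : (@lebesgue_measure R).-integrable setT (EFin \o h).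
  by rewrite -restrict_EFin; apply/integrable_restrict => //=; rewrite setTI.
have ihS (A : set R) : measurable A -> (@lebesgue_measure R).-integrable A (EFin \o h).
  by move=> mA; apply: (integrableS _ _ _ ih).
pose F x := \int[@lebesgue_measure R]_(t in [set` `]-oo, x]]) h t.
have ndF : {homo F : s t / s <= t}.
  move=> s t st; rewrite /F /Rintegral fine_le//.
  - by apply: integrable_fin_num; [exact: measurable_itv|exact: ihS].
  - by apply: integrable_fin_num; [exact: measurable_itv|exact: ihS].
  apply: ge0_subset_integral => //.
  - by have /ihS/integrableP[] : measurable ([set` `]-oo, t]] : set R) by exact: measurable_itv.
  - by move=> x _; rewrite lee_fin.
  - by apply: subset_itvl; rewrite bnd_simp.
have F0 : 0 <= F 0 by apply: Rintegral_ge0.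
have Fr : F r <= \int[@lebesgue_measure R]_(t in `[0, 1]) g t.
  have -> : \int[@lebesgue_measure R]_(t in `[0, 1]) g t =
      \int[@lebesgue_measure R]_(t in setT) h t.
    by rewrite /Rintegral [in LHS]integral_mkcond/= restrict_EFin.
  rewrite /F /Rintegral fine_le//.
  - by apply: integrable_fin_num; [exact: measurable_itv|exact: ihS].
  - by apply: integrable_fin_num.
  apply: ge0_subset_integral => //.
  - by case/integrableP : ih.
  - by move=> x _; rewrite lee_fin.
have lh : locally_integrable setT h.
  by apply: integrable_locally => //; exact: openT.
have Fae := FTC1Ny (fun y => ihS _ (measurable_itv _)) lh.
have := @abs_continuous01_le _ f F acf ndF _ r r01.
suff H : {ae @lebesgue_measure R, forall t : R, 0 <= t <= 1 -> exists a b : R,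
      [/\ is_derive t 1 f a, is_derive t 1 F b & a <= b]}.
  by move=> /(_ H) /le_trans; apply; rewrite lerBlDr (le_trans Fr)// lerDl F0.
apply: (ae_lebesgueS2 _ Fae fae) => t [dF Ft] fa t01.
have [a dfa ag] := fa t01.
exists a, (h t); split; first exact: dfa.
  by apply: DeriveDef; [exact: dF|rewrite -Ft derive1E].
by rewrite /h patchE mem_set//= in_itv.
Qed.

Lemma abs_continuous01_dist_le (f g : R -> R) : abs_continuous01 f ->
  (@lebesgue_measure R).-integrable `[0, 1] (EFin \o g) ->
  {ae @lebesgue_measure R, forall t : R, 0 <= t <= 1 ->
     exists2 a : R, is_derive t 1 f a & `|a| <= g t} ->
  (forall t, 0 <= t <= 1 -> 0 <= g t) ->
  forall r, 0 <= r <= 1 ->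
  `|f r - f 0| <= \int[@lebesgue_measure R]_(t in `[0, 1]) g t.
Proof.
move=> acf ig fae g0 r r01; rewrite ler_norml lerNl; apply/andP; split.
  have := @abs_continuous01_le_integral (fun t => -1 * f t) g
     (abs_continuous01Z _ acf) ig g0 _ r r01.
  rewrite !mulN1r !opprD; apply.
  apply: (ae_lebesgueS _ fae) => t ft /ft[a fa ag]; exists (- a).
    by rewrite (_ : (fun _ => _) = - f); [exact: is_deriveN|apply/funext => x; rewrite mulN1r].
  by rewrite (le_trans _ ag)// -normrN ler_norm.
apply: abs_continuous01_le_integral => //.
apply: (ae_lebesgueS _ fae) => t ft /ft[a fa ag]; exists a => //.
by rewrite (le_trans _ ag)// ler_norm.
Qed.

(** Clamping the time extends the function to a continuous one. *)
Lemma abs_continuous01_measurable (f : R -> R) : abs_continuous01 f ->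
  measurable_fun (`[0, 1] : set R) f.
Proof.
move=> acf; pose c (t : R) := Num.max 0 (Num.min 1 t).
have c01 t : 0 <= c t <= 1 by rewrite /c le_max lexx ge_max ler01 ge_min lexx.
apply: (@eq_measurable_fun _ _ _ _ _ (f \o c)).
  move=> t; rewrite inE/= in_itv/= => /andP[t0 t1].
  by rewrite /c (min_idPr t1) (max_idPr t0).
apply: measurable_funTS; apply: continuous_measurable_fun.
move=> t; apply/cvgrPdist_lt => e e0 /=.
have [d d0 fd] := abs_continuous01P acf e0.
have cd1 x y : c x - c y <= `|x - y|.
  have cE z : c z = if z <= 0 then 0 else if 1 <= z then 1 else z.
    by rewrite /c; case: (leP z 0) => z0; case: (leP 1 z) => z1; case: leP => ?; lra.
  have := ler_norm (x - y); have := normr_ge0 (x - y); move: `|_| => n n0 xyn.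
  rewrite !cE; case: (leP x 0) => x0; case: (leP y 0) => y0;
  case: (leP 1 x) => x1; case: (leP 1 y) => y1; clear -n0 xyn x0 y0 x1 y1; lra.
have cd s : `|c t - c s| <= `|t - s|.
  by rewrite ler_norml cd1 andbT lerNl opprB distrC cd1.
have fd2 x y : 0 <= x -> x <= y -> y <= 1 -> y - x < d -> `|f y - f x| < e.
  move=> x0 xy y1 xyd; have := fd unit (fun=> x) (fun=> y).
  by rewrite !big_const card_unit/= !addr0; apply => // -[] [].
near=> s.
have tsd : `|c t - c s| < d by rewrite (le_lt_trans (cd s))//; near: s; exact: cvgr_dist_lt.
have /andP[ct0 ct1] := c01 t; have /andP[cs0 cs1] := c01 s.
have [h|/ltW h] := leP (c t) (c s).
  by rewrite distrC fd2// (le_lt_trans _ tsd)// distrC ler_norm.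
by rewrite fd2// (le_lt_trans _ tsd)// ler_norm.
Unshelve. all: by end_near. Qed.
End IntegralBound.

(** * Affine changes of time *)

(** Source and target are the carrier of the Lebesgue measure. *)
Definition affine (R : realType) (a c : R) (t : measurableTypeR R) :
  measurableTypeR R := (a + c * t)%R.

Section Affine.
Context {R : realType}.
Variables (a c : R).
Hypothesis c0 : c != 0.

Let measurable_affine : measurable_fun setT (affine a c).
Proof. by apply: measurable_funD => //; exact: measurable_funM. Qed.

Let image_measure : {measure set (measurableTypeR R) -> \bar R} :=
  measure_function_pushforward__canonical__measure_function_Measure
    lebesgue_measure measurable_affine.

Let k : {nonneg R} := NngNum (normr_ge0 c).

Lemma affine_preimage_itv (x y : R) :
  affine a c @^-1` `]x, y]%classic =
  if 0 < c then `](x - a) / c, (y - a) / c]%classic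
  else `[(y - a) / c, (x - a) / c[%classic.
Proof.
apply/seteqP; split => t.
  case: ifPn => [cp|]; last rewrite -leNgt => cn; rewrite /affine /= !in_itv/=.
    by rewrite ltr_pdivrMr// ler_pdivlMr// ltrBlDl lerBrDl [t * c]mulrC.
  have cN : c < 0 by rewrite lt_neqAle c0.
  by rewrite ler_ndivrMr// ltr_ndivlMr// lerBrDl ltrBlDl [t * c]mulrC andbC.
case: ifPn => [cp|]; last rewrite -leNgt => cn; rewrite /affine /= !in_itv/=.
  by rewrite ltr_pdivrMr// ler_pdivlMr// ltrBlDl lerBrDl [t * c]mulrC.
have cN : c < 0 by rewrite lt_neqAle c0.
by rewrite ler_ndivrMr// ltr_ndivlMr// lerBrDl ltrBlDl [t * c]mulrC andbC.
Qed.

Let lebesgue_affine (A : set (measurableTypeR R)) : measurable A ->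
  lebesgue_measure A = mscale k image_measure A.
Proof.
move=> mA; apply: lebesgue_measure_unique => //= _ [[x y]] _ <-.
rewrite /mscale/= /image_measure/= /pushforward affine_preimage_itv.
case: ifPn => [cp|]; last rewrite -leNgt => cn; rewrite !lebesgue_measure_itv/= !lte_fin.
  rewrite ltr_pM2r ?invr_gt0// ltrD2r; case: ifP => _; last by rewrite mule0.
  rewrite gtr0_norm// -!EFinB -EFinM; congr EFin.
  by rewrite mulrBr !mulrA ![c * _]mulrC !mulfK//; ring.
have cN : c < 0 by rewrite lt_neqAle c0.
rewrite ltr_nM2r ?invr_lt0// ltrD2r; case: ifP => _; last by rewrite mule0.
rewrite ltr0_norm// -!EFinB -EFinM; congr EFin.
by rewrite mulNr mulrBr !mulrA ![c * _]mulrC !mulfK//; ring.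
Qed.

Lemma ae_affine (P : R -> Prop) : {ae @lebesgue_measure R, forall t : R, P t} ->
  {ae @lebesgue_measure R, forall t : R, P (a + c * t)}.
Proof.
move=> [A [mA A0 PA]]; exists (affine a c @^-1` A); split.
- by rewrite -[X in measurable X]setTI; exact: measurable_affine.
- have := lebesgue_affine mA; rewrite [LHS]A0 => /esym/eqP.
  by rewrite /mscale/= mule_eq0 eqe normr_eq0 (negbTE c0)/= => /eqP.
- by move=> t /= nP; exact: PA.
Qed.

Let ge0_integral_affine (D : set R) (f : R -> \bar R) : measurable D ->
  measurable_fun D f -> (forall t, D t -> (0 <= f t)%E) ->
  (\int[@lebesgue_measure R]_(t in D) f t =
   `|c|%:E * \int[@lebesgue_measure R]_(t in [set t | D (a + c * t)%R]) f (a + c * t)%R)%E.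
Proof.
move=> mD mf f0.
have -> : (\int[@lebesgue_measure R]_(t in D) f t =
   \int[mscale k image_measure]_(t in D) f t)%E.
  by apply: eq_measure_integral => A mA _; exact: lebesgue_affine.
rewrite ge0_integral_mscale//; congr (_ * _)%E.
rewrite (ge0_integral_pushforward measurable_affine)//.
by move=> t; rewrite inE; exact: f0.
Qed.

(** The shape in which a squared speed is transformed by a change of time. *)
Lemma integral_rescale (D E : set R) (f : R -> R) :
  measurable D -> measurable E -> (forall t, E t <-> D (a + c * t)) ->
  measurable_fun D f -> (forall t, 0 <= f t) ->
  (\int[@lebesgue_measure R]_(t in E) (c ^+ 2 * f (a + c * t))%:E =
   `|c|%:E * \int[@lebesgue_measure R]_(t in D) (f t)%:E)%E.
Proof.
move=> mD mE ED mf f0.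
have mh : measurable_fun E (fun t => (f (a + c * t))%:E).
  apply/measurable_EFinP.
  apply: (@measurable_comp _ _ _ _ _ _ D f _ (fun t => a + c * t)) => //.
    by move=> _ [t /ED Dt <-].
  by apply: measurable_funTS; exact: measurable_affine.
have fD0 t : D t -> (0 <= (f t)%:E)%E by rewrite lee_fin.
have mfE : measurable_fun D (fun t => (f t)%:E) by exact/measurable_EFinP.
have -> := ge0_integral_affine mD mfE fD0.
have -> : [set t | D (a + c * t)] = E by apply/seteqP; split => t /ED.
rewrite muleA -EFinM -normrM -expr2 ger0_norm ?sqr_ge0//.
have h0 t : E t -> (0 <= (f (a + c * t))%:E)%E by rewrite lee_fin.
have k0 : (0 <= (c ^+ 2)%:E)%E by rewrite lee_fin sqr_ge0.
apply: etrans (ge0_integralZl (@lebesgue_measure R) mE mh h0 k0).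
by apply: eq_integral => t _; rewrite EFinM.
Qed.

End Affine.

(** * Curves of densities *)

Section Curves.
Context {R : realType} {X : finType}.
Variables (Q : X -> X -> R) (pi : X -> R).
Hypothesis chain : reversible_chain Q pi.
Implicit Types (r p : X -> R) (rho psi : R -> X -> R).

Definition energy r p : R :=
  2^-1 * \sum_x \sum_y (p x - p y) ^+ 2 * logmean (r x) (r y) * Q x y * pi x.

Let Q0 x y : 0 <= Q x y. Proof. exact: (rate_ge0 chain). Qed.
Let pi0 x : 0 < pi x. Proof. exact: (pi_gt0 chain). Qed.

Lemma energy_ge0 r p : 0 <= energy r p.
Proof.
rewrite /energy mulr_ge0 ?invr_ge0 ?ler0n//.
apply: sumr_ge0 => x _; apply: sumr_ge0 => y _.
by rewrite 3?mulr_ge0 ?sqr_ge0 ?logmean_ge0 ?Q0 ?ltW.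
Qed.

Lemma energyZ r p c : energy r (fun x => c * p x) = c ^+ 2 * energy r p.
Proof.
rewrite /energy mulrCA; congr (_ * _); rewrite mulr_sumr; apply: eq_bigr => x _.
rewrite mulr_sumr; apply: eq_bigr => y _; rewrite -mulrBr exprMn; ring.
Qed.

Lemma measurable_energy d (T : measurableType d) (D : set T) (rho psi : T -> X -> R) :
  measurable D -> (forall x, measurable_fun D (rho ^~ x)) ->
  (forall x, measurable_fun D (psi ^~ x)) ->
  (forall t, D t -> forall x, 0 <= rho t x) ->
  measurable_fun D (fun t => energy (rho t) (psi t)).
Proof.
move=> mD mr mp r0; apply: measurable_funM => //.
apply: measurable_sum => x; apply: measurable_sum => y.
do 2 apply: measurable_funM => //; apply: measurable_funM.
  by apply: measurable_funX; exact: measurable_funB.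
by apply: measurable_logmean => // t Dt; exact: r0.
Qed.

(** The right-hand side of the continuity equation. *)
Definition velocity r p (x : X) : R :=
  - \sum_y (p y - p x) * logmean (r x) (r y) * Q x y.

Lemma velocityZ r p c x : velocity r (fun x => c * p x) x = c * velocity r p x.
Proof.
rewrite /velocity mulrN mulr_sumr; congr (- _); apply: eq_bigr => y _.
by rewrite -mulrBr -!mulrA.
Qed.

Lemma admissible_measurable r0 r1 rho psi : admissible Q pi r0 r1 rho psi ->
  measurable_fun (`[0, 1] : set R) (fun t => energy (rho t) (psi t)).
Proof.
move=> [dr acr _ mp _]; apply: measurable_energy => //.
- by move=> x; exact: abs_continuous01_measurable.
- by move=> t; rewrite /= in_itv/= => /dr[].
Qed.

Lemma actionE r0 r1 rho psi : admissible Q pi r0 r1 rho psi ->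
  action Q pi rho psi =
  (\int[@lebesgue_measure R]_(t in `[0%R, 1%R]) (energy (rho t) (psi t))%:E)%E.
Proof.
move=> adm; have me := admissible_measurable adm.
have E t : \sum_x \sum_y (psi t x - psi t y) ^+ 2 *
       logmean (rho t x) (rho t y) * Q x y * pi x = 2 * energy (rho t) (psi t).
  by rewrite /energy mulrA divff// mul1r.
rewrite /action; under eq_integral do rewrite E EFinM.
rewrite ge0_integralZl//.
- by rewrite muleA -EFinM mulVf// mul1e.
- exact/measurable_EFinP.
- by move=> t _; rewrite lee_fin energy_ge0.
Qed.

(** Upper bounds of actions compose, average and restrict along with the curves
    which realise them, whereas distances only have almost optimal curves. *)
Definition cost_le r0 r1 (c : R) : Prop := exists rho psi,
  admissible Q pi r0 r1 rho psi /\ (action Q pi rho psi <= c%:E)%E.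

Lemma cost_leW r0 r1 c c' : c <= c' -> cost_le r0 r1 c -> cost_le r0 r1 c'.
Proof.
move=> cc [rho [psi [adm le]]]; exists rho, psi; split => //.
by rewrite (le_trans le)// lee_fin.
Qed.

Lemma cost_le_refl r : density pi r -> cost_le r r 0.
Proof.
move=> dr; exists (fun=> r), (fun _ _ => 0).
have adm : admissible Q pi r r (fun=> r) (fun _ _ => 0).
  split => //.
  - by move=> x; exact: abs_continuous01_cst.
  - apply: aeW => t _ x.
    have -> : - (\sum_y (0 - 0) * logmean (r x) (r y) * Q x y) = 0.
      by rewrite oppr0 big1 ?oppr0// => y _; rewrite addr0 !mul0r.
    exact: (@is_derive_cst _ _ _ (r x)).
split => //; rewrite (actionE adm) integral0_eq// => t _; congr EFin.
rewrite /energy big1 ?mulr0// => x _; rewrite big1// => y _.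
by rewrite subrr expr0n/= !mul0r.
Qed.

(** Running a piece of a curve, forwards or backwards, at constant relative
    speed. *)
Lemma admissible_affine r0 r1 rho psi a b : admissible Q pi r0 r1 rho psi ->
  0 <= a <= 1 -> 0 <= b <= 1 -> a != b ->
  let rho' t := rho (a + (b - a) * t) in
  let psi' t x := (b - a) * psi (a + (b - a) * t) x in
  admissible Q pi (rho a) (rho b) rho' psi' /\
  (action Q pi rho' psi' = `|b - a|%:E *
     \int[@lebesgue_measure R]_(t in [set` `[Num.min a b, Num.max a b]])
        (energy (rho t) (psi t))%:E)%E.
Proof.
move=> adm a01 b01 ab rho' psi'.
have me := admissible_measurable adm.
move: (adm) => [dr acr [rE0 rE1] mp ode].
have c0 : b - a != 0 by rewrite subr_eq0 eq_sym.
have in01 t : 0 <= t <= 1 -> 0 <= a + (b - a) * t <= 1.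
  move: a01 b01 => /andP[? ?] /andP[? ?] /andP[? ?]; apply/andP; split; nra.
have maff : measurable_fun setT (fun t : R => a + (b - a) * t).
  by apply: measurable_funD => //; exact: measurable_funM.
have img : [set a + (b - a) * t | t in (`[0, 1] : set R)] `<=` (`[0, 1] : set R).
  by move=> _ [t + <-]; rewrite /= !in_itv/=; exact: in01.
have adm' : admissible Q pi (rho a) (rho b) rho' psi'.
  split.
  - by move=> t /in01; exact: dr.
  - move=> x; apply: (@abs_continuous01_comp _ (rho ^~ x) _ `|b - a|) => //.
      move=> s t st; have -> : a + (b - a) * t - (a + (b - a) * s) = (b - a) * (t - s).
        by ring.
      by rewrite normrM [X in _ * X]ger0_norm// subr_ge0.
    have [cp|cn] := leP 0 (b - a); [left|right] => s t st.
      by rewrite lerD2l ler_wpM2l.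
    by rewrite lerD2l ler_wnM2l// ltW.
  - by rewrite /rho' mulr0 addr0 mulr1 subrKC.
  - move=> x; apply: measurable_funM => //.
    apply: (@measurable_comp _ _ _ _ _ _ (`[0, 1] : set R) (psi ^~ x)) => //.
    exact: measurable_funTS.
  - have := ae_affine a c0 ode; apply: ae_lebesgueS => t /= ht t01 x.
    rewrite -[X in is_derive _ _ _ X]/(velocity (rho' t) (psi' t) x) velocityZ mulrC.
    apply: (@is_derive1_comp _ (rho ^~ x) (fun s => a + (b - a) * s)).
      exact: ht (in01 _ t01) x.
    by apply: is_derive_eq; rewrite /GRing.scale/= mulr1 add0r mul1r.
split=> //; rewrite (actionE adm').
have sub01 : [set` `[Num.min a b, Num.max a b]] `<=` (`[0, 1] : set R).
  move=> t; rewrite /= !in_itv/= le_max ge_min.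
  by move: a01 b01 => /andP[? ?] /andP[? ?] /andP[/orP[] ? /orP[] ?]; apply/andP; split; lra.
pose D := [set` `[Num.min a b, Num.max a b]] : set R.
have mD : measurable D by exact: measurable_itv.
have mfD : measurable_fun D (fun t => energy (rho t) (psi t)).
  exact: (@measurable_funS _ _ _ _ (`[0, 1]%classic : set R)).
have ED (t : R) : `[0, 1]%classic t <-> D (a + (b - a) * t).
  have := c0; rewrite /D /Num.min /Num.max; case: ifPn => [ablt|]; last rewrite -leNgt => bale.
    move=> _; have cp : 0 < b - a by rewrite subr_gt0.
    by split; rewrite /= !in_itv/= => /andP[? ?]; apply/andP; split; nra.
  move=> c0'; have cp : b - a < 0 by rewrite lt_neqAle c0' subr_le0.
  by split; rewrite /= !in_itv/= => /andP[? ?]; apply/andP; split; nra.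
apply: etrans (integral_rescale c0 mD (measurable_itv _) ED mfD (fun t => energy_ge0 _ _)).
by apply: eq_integral => t _; rewrite /psi' energyZ.
Qed.

Lemma cost_le_sym r0 r1 c : cost_le r0 r1 c -> cost_le r1 r0 c.
Proof.
move=> [rho [psi [adm le]]]; have [_ _ [rE0 rE1] _ _] := adm.
have h1 : 0 <= (1 : R) <= 1 by rewrite ler01 lexx.
have h0 : 0 <= (0 : R) <= 1 by rewrite ler01 lexx.
have [adm' actE] := admissible_affine adm h1 h0 (oner_neq0 R).
rewrite rE0 rE1 in adm'.
eexists; eexists; split; first exact: adm'.
apply: le_trans le; rewrite actE (actionE adm) (min_idPr ler01) (max_idPl ler01).
rewrite sub0r normrN1 mul1e; exact: lexx.
Qed.

End Curves.

Section Concatenation.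
Context {R : realType} {X : finType}.
Variables (Q : X -> X -> R) (pi : X -> R).
Hypothesis chain : reversible_chain Q pi.
Implicit Types (r p : X -> R) (rho psi : R -> X -> R).

Let measurable_affine_comp (f : R -> R) (a c : R) (D : set R) : measurable D ->
  measurable_fun (`[0, 1] : set R) f -> (forall t, D t -> 0 <= a + c * t <= 1) ->
  measurable_fun D (fun t => f (a + c * t)).
Proof.
move=> mD mf D01.
apply: (@measurable_comp _ _ _ _ _ _ (`[0, 1] : set R) f _ (fun t => a + c * t)) => //.
  by move=> _ [t Dt <-]; rewrite /= in_itv/=; exact: D01.
by apply: measurable_funTS; apply: measurable_funD => //; exact: measurable_funM.
Qed.

Let clamp_lip (x y : R) : x <= y ->
  (Num.min 1 x <= Num.min 1 y /\ Num.min 1 y - Num.min 1 x <= y - x) /\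
  (Num.max 0 x <= Num.max 0 y /\ Num.max 0 y - Num.max 0 x <= y - x).
Proof.
by move=> xy; case: (leP 1 x) => ?; case: (leP 1 y) => ?;
  case: (leP 0 x) => ?; case: (leP 0 y) => ?; split; split; lra.
Qed.

(** The time spent on each piece is the fraction [s], respectively [1 - s]. *)
Lemma cost_le_concat r0 r1 r2 (A B s : R) : 0 < s < 1 ->
  cost_le Q pi r0 r1 A -> cost_le Q pi r1 r2 B ->
  cost_le Q pi r0 r2 (A / s + B / (1 - s)).
Proof.
move=> /andP[s0 s1] [rho1 [psi1 [adm1 le1]]] [rho2 [psi2 [adm2 le2]]].
pose c1 := s^-1; pose c2 := (1 - s)^-1; pose a2 := - (c2 * s).
have c10 : 0 < c1 by rewrite invr_gt0.
have c20 : 0 < c2 by rewrite invr_gt0 subr_gt0.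
have c1s : c1 * s = 1 by rewrite /c1 mulVf// gt_eqF.
have c2s : c2 * (1 - s) = 1 by rewrite /c2 mulVf// gt_eqF// subr_gt0.
have u2E t : a2 + c2 * t = c2 * (t - s) by rewrite /a2; ring.
have u1le t : 0 <= t -> t <= s -> 0 <= 0 + c1 * t <= 1.
  by move=> t0 ts; rewrite add0r mulr_ge0 ?(ltW c10)//= -c1s ler_wpM2l// ltW.
have u2le t : s <= t -> t <= 1 -> 0 <= a2 + c2 * t <= 1.
  move=> st t1; rewrite u2E.
  by rewrite mulr_ge0 ?subr_ge0 ?(ltW c20)//= -c2s ler_wpM2l ?(ltW c20)// lerD2r.
have u1ge t : s <= t -> 1 <= 0 + c1 * t.
  by move=> st; rewrite add0r -c1s ler_wpM2l// ltW.
have u2ge t : t <= s -> a2 + c2 * t <= 0.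
  by move=> st; rewrite u2E mulr_ge0_le0 ?subr_le0// ltW.
pose v1 t := Num.min 1 (0 + c1 * t); pose v2 t := Num.max 0 (a2 + c2 * t).
pose rho t x := rho1 (v1 t) x + rho2 (v2 t) x - r1 x.
pose psi t x := if t <= s then c1 * psi1 (0 + c1 * t) x else c2 * psi2 (a2 + c2 * t) x.
have [dr1 ac1 [r10 r11] mp1 ode1] := adm1; have [dr2 ac2 [r20 r21] mp2 ode2] := adm2.
have me1 := admissible_measurable adm1; have me2 := admissible_measurable adm2.
have rhoE1 t : t <= s -> rho t = rho1 (0 + c1 * t).
  move=> ts; apply/funext => x; rewrite /rho /v2 (max_idPl (u2ge _ ts)) r20 addrK.
  by rewrite /v1 (min_idPr _)// add0r -c1s ler_wpM2l// ltW.
have rhoE2 t : s <= t -> rho t = rho2 (a2 + c2 * t).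
  move=> ts; apply/funext => x; rewrite /rho /v1 (min_idPl (u1ge _ ts)) r11.
  rewrite addrAC subrr add0r /v2 (max_idPr _)// u2E.
  by rewrite mulr_ge0 ?subr_ge0// ltW.
have adm : admissible Q pi r0 r2 rho psi.
  split.
  - move=> t /andP[t0 t1]; have [ts|/ltW st] := leP t s.
      by rewrite rhoE1//; apply: dr1; exact: u1le.
    by rewrite rhoE2//; apply: dr2; exact: u2le.
  - move=> x; have ac01 (f v : R -> R) k : 0 <= k -> abs_continuous01 f ->
        (forall t, 0 <= t <= 1 -> 0 <= v t <= 1) ->
        (forall a b, a <= b -> v a <= v b /\ v b - v a <= k * (b - a)) ->
        abs_continuous01 (f \o v).
      move=> k0 acf v01 vk; apply: (abs_continuous01_comp acf v01 (k := k)).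
        by move=> a b /vk[vab ?]; rewrite ger0_norm ?subr_ge0.
      by left => a b /vk[].
    apply: abs_continuous01D; last exact: abs_continuous01_cst.
    apply: abs_continuous01D.
      apply: (ac01 (rho1 ^~ x) v1 c1) => //; first exact: ltW.
        move=> t /andP[t0 t1]; rewrite /v1 le_min ler01 ge_min lexx add0r mulr_ge0//.
        exact: ltW.
      move=> a b ab; have cab : c1 * a <= c1 * b by rewrite ler_wpM2l// ltW.
      by rewrite /v1 !add0r mulrBr; exact: (clamp_lip cab).1.
    apply: (ac01 (rho2 ^~ x) v2 c2) => //; first exact: ltW.
      move=> t /andP[t0 t1]; rewrite /v2 ge_max ler01 le_max lexx/=.
      by have [st|/ltW ts] := leP s t; [case/andP: (u2le t st t1)|rewrite (le_trans (u2ge t ts))].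
    move=> a b ab; have cab : c2 * a <= c2 * b by rewrite ler_wpM2l// ltW.
    have cab' : a2 + c2 * a <= a2 + c2 * b by rewrite lerD2l.
    have [_] := clamp_lip cab'; rewrite /v2 mulrBr.
    by rewrite (_ : a2 + c2 * b - (a2 + c2 * a) = c2 * b - c2 * a)//; ring.
  - split; first by rewrite rhoE1 ?mulr0 ?addr0 ?r10// ltW.
    rewrite rhoE2 ?(ltW s1)// (_ : a2 + c2 * 1 = 1) ?r21//.
    by rewrite u2E.
  - move=> x; apply: measurable_fun_if => //.
    + exact: measurable_fun_ler.
    + apply: measurable_funM => //.
      apply: (@measurable_affine_comp (psi1 ^~ x)) => //.
        exact: measurable_fun_ler.
      by move=> t [+ /eqP]; rewrite /= in_itv/= eqb_id => /andP[t0 _]; exact: u1le.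
    + apply: measurable_funM => //.
      apply: (@measurable_affine_comp (psi2 ^~ x)) => //.
        exact: measurable_fun_ler.
      move=> t [+ /eqP]; rewrite /= in_itv/= eqbF_neg -ltNge => /andP[_ t1] /ltW st.
      exact: u2le.
  - have o1 := ae_affine 0 (lt0r_neq0 c10) ode1.
    have o2 := ae_affine a2 (lt0r_neq0 c20) ode2.
    have ns : {ae @lebesgue_measure R, forall t : R, t != s}.
      exists [set s]; split => //; first exact: lebesgue_measure_set1.
      by move=> t /= /negP; rewrite negbK => /eqP.
    apply: (ae_lebesgueS2 _ ns (ae_lebesgueI o1 o2)).
    move=> t ts [/= h1 h2] /andP[t0 t1] x.
    rewrite -[X in is_derive _ _ _ X]/(velocity Q (rho t) (psi t) x).
    have [tls|sgt|/eqP] := ltgtP t s; last by rewrite (negbTE ts).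
      have -> : velocity Q (rho t) (psi t) x =
          velocity Q (rho1 (0 + c1 * t)) (psi1 (0 + c1 * t)) x * c1.
        rewrite [RHS]mulrC -velocityZ rhoE1 ?(ltW tls)//.
        congr (velocity Q _ _ x).
        by apply/funext => y; rewrite /psi (ltW tls).
      apply: (@near_eq_is_derive _ _ _ ((rho1 ^~ x) \o (fun t => 0 + c1 * t))).
        by near=> z; rewrite rhoE1//; apply: ltW; near: z; exact: lt_nbhsl.
      apply: is_derive1_comp; first exact: h1 (u1le _ t0 (ltW tls)) x.
      by apply: is_derive_eq; rewrite /GRing.scale/= mulr1 !add0r mul1r.
    have -> : velocity Q (rho t) (psi t) x =
        velocity Q (rho2 (a2 + c2 * t)) (psi2 (a2 + c2 * t)) x * c2.
      rewrite [RHS]mulrC -velocityZ rhoE2 ?(ltW sgt)//.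
      congr (velocity Q _ _ x).
      by apply/funext => y; rewrite /psi leNgt sgt.
    apply: (@near_eq_is_derive _ _ _ ((rho2 ^~ x) \o (fun t => a2 + c2 * t))).
      by near=> z; rewrite rhoE2//; apply: ltW; near: z; exact: lt_nbhsr.
    apply: is_derive1_comp; first exact: h2 (u2le _ (ltW sgt) t1) x.
    by apply: is_derive_eq; rewrite /GRing.scale/= mulr1 !add0r mul1r.
exists rho, psi; split; first exact: adm.
rewrite (actionE chain adm).
pose f1 t := energy Q pi (rho1 t) (psi1 t); pose f2 t := energy Q pi (rho2 t) (psi2 t).
pose e t := energy Q pi (rho t) (psi t).
have E1 t : t <= s -> e t = c1 ^+ 2 * f1 (0 + c1 * t).
  move=> ts; rewrite /e rhoE1// -energyZ; congr energy.
  by apply/funext => x; rewrite /psi ts.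
have E2 t : s < t -> e t = c2 ^+ 2 * f2 (a2 + c2 * t).
  move=> ts; rewrite /e rhoE2 ?ltW// -energyZ; congr energy.
  by apply/funext => x; rewrite /psi leNgt ts.
have me : measurable_fun (`[0, 1] : set R) (fun t => (e t)%:E).
  by apply/measurable_EFinP; exact: admissible_measurable adm.
have U01 : `[0, 1]%classic = (`[0, s]%classic `|` `]s, 1]%classic : set R).
  apply/seteqP; split => t; rewrite /= !in_itv/=.
    by move=> /andP[-> ->]; case: (leP t s) => _; [left|right].
  by move=> [/andP[-> /le_trans->]|/andP[/ltW st ->]] //;
    rewrite ?andbT ?(ltW s1)// (le_trans _ st)// ltW.
have mA : measurable (`[0, s]%classic : set R) by exact: measurable_itv.
have mB : measurable (`]s, 1]%classic : set R) by exact: measurable_itv.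
have mC : measurable (`[0, 1]%classic : set R) by exact: measurable_itv.
have mD : measurable (`]0, 1]%classic : set R) by exact: measurable_itv.
have I1 : (\int[@lebesgue_measure R]_(t in `[0%R, s]) (e t)%:E =
    c1%:E * \int[@lebesgue_measure R]_(t in `[0%R, 1%R]) (f1 t)%:E)%E.
  have H (t : R) : `[0, s]%classic t <-> `[0, 1]%classic (0 + c1 * t).
    rewrite /= !in_itv/= add0r -[X in _ * _ <= X]c1s; split => /andP[t0 ts].
      by rewrite mulr_ge0 ?(ltW c10)//= ler_wpM2l// ltW.
    by move: t0 ts; rewrite pmulr_rge0// ler_pM2l// => -> ->.
  have := integral_rescale (lt0r_neq0 c10) mC mA H me1 (fun t => energy_ge0 chain _ _).
  rewrite (gtr0_norm c10) => <-; apply: eq_integral => t.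
  by rewrite inE/= in_itv/= => /andP[_ ts]; rewrite E1.
have I2 : (\int[@lebesgue_measure R]_(t in `]s, 1%R]) (e t)%:E <=
    c2%:E * \int[@lebesgue_measure R]_(t in `[0%R, 1%R]) (f2 t)%:E)%E.
  have H (t : R) : `]s, 1]%classic t <-> `]0, 1]%classic (a2 + c2 * t).
    rewrite /= !in_itv/= u2E -[X in _ * _ <= X]c2s pmulr_rgt0// ler_pM2l//.
    by rewrite subr_gt0 lerD2r.
  have md : measurable_fun (`]0, 1]%classic : set R) f2.
    apply: (@measurable_funS _ _ _ _ (`[0, 1]%classic : set R)) => //.
    by apply: subset_itvr; rewrite bnd_simp.
  have := integral_rescale (lt0r_neq0 c20) mD mB H md (fun t => energy_ge0 chain _ _).
  rewrite (gtr0_norm c20) => h.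
  apply: (@le_trans _ _ (c2%:E * \int[@lebesgue_measure R]_(t in `]0%R, 1%R]) (f2 t)%:E)%E).
    rewrite -h le_eqVlt; apply/orP; left; apply/eqP; apply: eq_integral => t.
    by rewrite inE/= in_itv/= => /andP[ts _]; rewrite E2.
  apply: lee_wpmul2l; first by rewrite lee_fin ltW.
  apply: (ge0_subset_integral (@lebesgue_measure R) mD mC).
  - by apply/measurable_EFinP; exact: me2.
  - by move=> t _; rewrite lee_fin energy_ge0.
  - by apply: subset_itvr; rewrite bnd_simp.
rewrite U01 in me *.
apply: (@le_trans _ _ (\int[@lebesgue_measure R]_(t in `[0%R, s]) (e t)%:E +
    \int[@lebesgue_measure R]_(t in `]s, 1%R]) (e t)%:E)%E).
  rewrite le_eqVlt; apply/orP; left; apply/eqP; apply: ge0_integral_setU => //.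
    by move=> t _; rewrite lee_fin energy_ge0.
  apply/disj_setPS => t [/=]; rewrite !in_itv/= => /andP[_ ts] /andP[st _].
  by move: (lt_le_trans st ts); rewrite ltxx.
rewrite I1 EFinD; apply: leeD.
  rewrite mulrC EFinM; apply: lee_wpmul2l; first by rewrite lee_fin ltW.
  by rewrite -(actionE chain adm1).
apply: (le_trans I2); rewrite [B / _]mulrC EFinM; apply: lee_wpmul2l.
  by rewrite lee_fin ltW.
by rewrite -(actionE chain adm2).
Unshelve. all: by end_near. Qed.

End Concatenation.

(** * Weighted graph Laplacians *)

Section Network.
Context {R : realFieldType} {X : finType}.
Implicit Types (w : X -> X -> R) (p q f u : X -> R).

Definition laplacian w p x : R := \sum_y (p y - p x) * w x y.

Lemma laplacian_parts w p q : (forall x y, w x y = w y x) ->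
  \sum_x q x * laplacian w p x =
  - (2^-1 * \sum_x \sum_y (q x - q y) * (p x - p y) * w x y).
Proof.
move=> wC; set S := LHS.
have S1 : S = \sum_x \sum_y q x * (p y - p x) * w x y.
  by apply: eq_bigr => x _; rewrite mulr_sumr; apply: eq_bigr => y _; rewrite mulrA.
have S2 : S = \sum_x \sum_y q y * (p x - p y) * w x y.
  rewrite S1 exchange_big/=; apply: eq_bigr => x _; apply: eq_bigr => y _.
  by rewrite wC.
have : S + S = - \sum_x \sum_y (q x - q y) * (p x - p y) * w x y.
  rewrite {1}S1 S2 -big_split/= -sumrN; apply: eq_bigr => x _.
  rewrite -big_split/= -sumrN; apply: eq_bigr => y _; ring.
by move=> ?; lra.
Qed.

(** The conducting edges, recorded as an element of a finite type so that
    choices depending on them alone are measurable in the weights. *)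
Definition support_graph w : {ffun X * X -> bool} := [ffun xy => 0 < w xy.1 xy.2].

Definition edge_of (G : {ffun X * X -> bool}) : rel X := fun x y => G (x, y).

(** One vertex per connected component carries a unit mass; grounding the
    network there makes the Laplacian invertible. *)
Definition ground (G : {ffun X * X -> bool}) (x : X) : R :=
  (fingraph.root (edge_of G) x == x)%:R.

Definition grounded_matrix w : 'M[R]_#|X| := \matrix_(i, j)
  ((i == j)%:R * (\sum_z w (enum_val i) z + ground (support_graph w) (enum_val i))
   - w (enum_val i) (enum_val j)).

Definition potential w f x : R := - \sum_j f (enum_val j) *
  ((\det (grounded_matrix w))^-1 * \adj (grounded_matrix w) j (enum_rank x)).

Section Solve.
Variable w : X -> X -> R.
Hypothesis wC : forall x y, w x y = w y x.
Hypothesis w0 : forall x y, 0 <= w x y.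

Let M := grounded_matrix w.
Let e := edge_of (support_graph w).
Let r := ground (support_graph w).

Let eE x y : e x y = (0 < w x y). Proof. by rewrite /e /edge_of ffunE. Qed.

Let e_sym : connect_sym e.
Proof. by apply: sym_connect_sym => x y; rewrite !eE wC. Qed.

Let mulM (v : 'rV[R]_#|X|) (x : X) : (v *m M) 0 (enum_rank x) =
  - laplacian w (fun y => v 0 (enum_rank y)) x + r x * v 0 (enum_rank x).
Proof.
rewrite mxE; under eq_bigr do rewrite mxE mulrBr; rewrite sumrB.
rewrite (bigD1 (enum_rank x))//= eqxx mul1r enum_rankK [X in _ + X - _]big1 ?addr0; last first.
  by move=> i /negbTE ->; rewrite mul0r mulr0.
rewrite /laplacian; under [in RHS]eq_bigr do rewrite mulrBl.
rewrite sumrB opprB -mulr_sumr mulrDr addrAC [r x * _]mulrC; congr (_ - _ + _).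
rewrite (reindex (@enum_rank X))/=; last first.
  by exists enum_val => i _; [exact: enum_rankK|exact: enum_valK].
by apply: eq_bigr => y _; rewrite enum_rankK wC.
Qed.

Let const_on_edges u x y : (forall x y, w x y != 0 -> u x = u y) ->
  connect e x y -> u x = u y.
Proof.
move=> cu /connectP[s + ->]; elim: s x => //= z s IH x /andP[+ /IH <-].
by rewrite eE => /lt0r_neq0/cu.
Qed.

(** A vector in the kernel has no energy, so it is constant on components, and
    it vanishes at the grounded vertices. *)
Lemma grounded_matrix_unit : M \in unitmx.
Proof.
rewrite -row_free_unit; apply: inj_row_free => v vM.
pose u y := v 0 (enum_rank y).
have E : \sum_x u x * (- laplacian w u x + r x * u x) = 0.
  by apply: big1 => x _; rewrite -mulM vM mxE mulr0.
have r0 x : 0 <= r x by rewrite ler0n.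
have : 2^-1 * \sum_x \sum_y (u x - u y) * (u x - u y) * w x y + \sum_x r x * u x ^+ 2 = 0.
  rewrite -[RHS]E; under [in RHS]eq_bigr do rewrite mulrDr mulrN.
  rewrite big_split/= sumrN laplacian_parts// opprK; congr (_ + _).
  by apply: eq_bigr => x _; ring.
have s0 x y : 0 <= (u x - u y) * (u x - u y) * w x y by rewrite mulr_ge0// -expr2 sqr_ge0.
have S0 x : 0 <= \sum_y (u x - u y) * (u x - u y) * w x y by apply: sumr_ge0.
have R0 x : 0 <= r x * u x ^+ 2 by rewrite mulr_ge0 ?sqr_ge0.
move/eqP; rewrite paddr_eq0 ?sumr_ge0//; last first.
  by rewrite mulr_ge0 ?invr_ge0 ?ler0n// sumr_ge0.
rewrite mulf_eq0 invr_eq0 pnatr_eq0/= !psumr_eq0//.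
move=> /andP[/allP h1 /allP h2].
have cu x y : w x y != 0 -> u x = u y.
  move=> wxy; have := h1 x (mem_index_enum x); rewrite /= psumr_eq0//.
  move=> /allP/(_ y (mem_index_enum y))/=.
  by rewrite !mulf_eq0 (negbTE wxy) orbF orbb subr_eq0 => /eqP.
have ru x : fingraph.root e x = x -> u x = 0.
  move=> rx; have := h2 x (mem_index_enum x).
  by rewrite /= /r /ground rx eqxx mul1r sqrf_eq0 => /eqP.
apply/rowP => i; rewrite mxE -(enum_valK i) -/(u _).
rewrite (const_on_edges cu (connect_root e _)); apply: ru.
by rewrite root_root.
Qed.

(** Summing the grounded equation over a connected component leaves only the
    current through its ground, which therefore vanishes when the source is
    balanced on the component. *)
Lemma laplacian_potential f :
  (forall u, (forall x y, w x y != 0 -> u x = u y) -> \sum_x u x * f x = 0) ->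
  forall x, laplacian w (potential w f) x = f x.
Proof.
move=> f0; pose fv : 'rV[R]_#|X| := \row_j - f (enum_val j).
pose v := fv *m ((\det M)^-1 *: \adj M).
have vM : v *m M = fv.
  rewrite -mulmxA -scalemxAl mul_adj_mx scale_scalar_mx mulVf ?mulmx1//.
  by have := grounded_matrix_unit; rewrite unitmxE unitfE.
pose p x := v 0 (enum_rank x).
have pE : potential w f = p.
  apply/funext => x; rewrite /p /v mxE /potential -sumrN; apply: eq_bigr => j _.
  by rewrite !mxE mulNr.
have pf x : - laplacian w p x + r x * p x = - f x.
  by rewrite -mulM vM mxE enum_rankK.
have rp x : r x * p x = 0.
  have [rx|rx] := eqVneq (fingraph.root e x) x; last first.
    by rewrite /r /ground -/e (negbTE rx) mul0r.
  pose u y : R := (connect e x y)%:R.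
  have cu y z : w y z != 0 -> u y = u z.
    move=> wyz; rewrite /u; congr (nat_of_bool _)%:R.
    by apply: same_connect_r => //; apply: connect1; rewrite eE lt_def wyz w0.
  have := f0 u cu.
  have -> : \sum_y u y * f y = \sum_y u y * laplacian w p y - \sum_y u y * (r y * p y).
    rewrite -sumrB; apply: eq_bigr => y _; rewrite -mulrBr; congr (_ * _).
    by have := pf y; lra.
  rewrite laplacian_parts// big1 ?mulr0 ?oppr0 ?sub0r; last first.
    move=> y _; apply: big1 => z _; have [->|/cu ->] := eqVneq (w y z) 0.
      by rewrite mulr0.
    by rewrite subrr !mul0r.
  move=> /eqP; rewrite oppr_eq0 (bigD1 x)//= big1 ?addr0.
    by rewrite /u connect0 mul1r => /eqP.
  move=> y yx; rewrite /u /r /ground -/e.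
  have [cxy|] := boolP (connect e x y); last by rewrite mul0r.
  have -> : fingraph.root e y = x by rewrite -rx; apply/esym/(fingraph.rootP e_sym).
  by rewrite eq_sym (negbTE yx) mul0r mulr0.
by move=> x; rewrite pE; have := pf x; rewrite rp; lra.
Qed.

End Solve.
End Network.

Section MeasurablePotential.
Context {R : realType} {X : finType} d {T : measurableType d}.
Variable (D : set T).
Hypothesis mD : measurable D.

Lemma measurable_det n (M : T -> 'M[R]_n) :
  (forall i j, measurable_fun D (fun t => M t i j)) ->
  measurable_fun D (fun t => \det (M t)).
Proof.
move=> mM; rewrite /determinant; apply: measurable_sum => s.
by apply: measurable_funM => //; apply: measurable_prod => i _; exact: mM.
Qed.

Let measurable_adj n (M : T -> 'M[R]_n) i j :
  (forall i j, measurable_fun D (fun t => M t i j)) ->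
  measurable_fun D (fun t => \adj (M t) i j).
Proof.
move=> mM.
have -> : (fun t => \adj (M t) i j) =
    (fun t => (-1) ^+ (j + i) * \det (row' j (col' i (M t)))).
  by apply/funext => t; rewrite mxE.
apply: measurable_funM => //; apply: measurable_det => k l.
have -> : (fun t => row' j (col' i (M t)) k l) = (fun t => M t (lift j k) (lift i l)).
  by apply/funext => t; rewrite !mxE.
exact: mM.
Qed.

(** The support graph takes finitely many values, each on a measurable set. *)
Let measurable_support_graph (w : T -> X -> X -> R) (F : {ffun X * X -> bool} -> R) :
  (forall x y, measurable_fun D (fun t => w t x y)) ->
  measurable_fun D (fun t => F (support_graph (w t))).
Proof.
move=> mw.
have -> : (fun t => F (support_graph (w t))) = (fun t => \sum_G F G *
    \prod_xy (if 0 < w t xy.1 xy.2 then (G xy)%:R else (~~ G xy)%:R)).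
  apply/funext => t; rewrite (bigD1 (support_graph (w t)))//= big1 ?mulr1.
    rewrite big1 ?addr0// => G /eqP Gw.
    have /existsP[xy Gxy] : [exists xy, G xy != support_graph (w t) xy].
      apply: contrapT => /negP; rewrite negb_exists => /forallP h; apply: Gw.
      by apply/ffunP => xy; apply/eqP; have := h xy; rewrite negbK.
    rewrite (bigD1 xy)//=.
    suff -> : (if 0 < w t xy.1 xy.2 then (G xy)%:R else (~~ G xy)%:R) = 0 :> R.
      by rewrite mul0r mulr0.
    move: Gxy; rewrite ffunE; case: ifPn => _; by case: (G xy).
  by move=> xy _; rewrite ffunE; case: (0 < w t xy.1 xy.2).
apply: measurable_sum => G; apply: measurable_funM => //.
apply: measurable_prod => xy _; apply: measurable_fun_if => //.
exact: measurable_fun_ltr.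
Qed.

Lemma measurable_potential (w : T -> X -> X -> R) (f : T -> X -> R) x :
  (forall x y, measurable_fun D (fun t => w t x y)) ->
  (forall x, measurable_fun D (fun t => f t x)) ->
  measurable_fun D (fun t => potential (w t) (f t) x).
Proof.
move=> mw mf.
have mM i j : measurable_fun D (fun t => grounded_matrix (w t) i j).
  have -> : (fun t => grounded_matrix (w t) i j) = (fun t => (i == j)%:R *
     (\sum_z w t (enum_val i) z + ground (support_graph (w t)) (enum_val i))
       - w t (enum_val i) (enum_val j)) by apply/funext => t; rewrite mxE.
  apply: measurable_funB => //; apply: measurable_funM => //; apply: measurable_funD.
    by apply: measurable_sum => z.
  exact: (measurable_support_graph (fun G => ground G (enum_val i)) mw).
have -> : (fun t => potential (w t) (f t) x) =
    (fun t => -1 * - potential (w t) (f t) x).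
  by apply/funext => t; rewrite mulN1r opprK.
apply: measurable_funM => //; rewrite /potential; under eq_fun do rewrite opprK.
apply: measurable_sum => j.
apply: measurable_funM => //; apply: measurable_funM; last exact: measurable_adj.
by apply: measurable_inv; exact: measurable_det.
Qed.

End MeasurablePotential.

(** * Superposition of curves *)

Lemma ae_lebesgue_forall (R : realType) (I : finType) (P : I -> R -> Prop) :
  (forall i, {ae @lebesgue_measure R, forall t : R, P i t}) ->
  {ae @lebesgue_measure R, forall t : R, forall i, P i t}.
Proof.
move=> Pae.
suff : {ae @lebesgue_measure R, forall t : R, forall i, i \in enum I -> P i t}.
  by apply: ae_lebesgueS => t h i; apply: h; rewrite mem_enum.
elim: (enum I) => [|i s IH]; first by apply: aeW => t i.
apply: (ae_lebesgueS2 _ (Pae i) IH) => t Pi Ps j.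
by rewrite inE => /predU1P[->//|/Ps].
Qed.

Lemma is_derive_lincomb (R : realType) (I : finType) (a d : I -> R)
    (f : I -> R -> R) (t : R) : (forall i, is_derive t 1 (f i) (d i)) ->
  is_derive t 1 (fun s => \sum_i a i * f i s) (\sum_i a i * d i).
Proof.
move=> df; elim: (index_enum I) => [|i r IH].
  rewrite big_nil (_ : (fun _ => _) = cst 0); first exact: is_derive_cst.
  by apply/funext => s; rewrite big_nil.
rewrite big_cons (_ : (fun s => \sum_(j <- i :: r) a j * f j s) =
    (a i \*: f i) + (fun s => \sum_(j <- r) a j * f j s)).
  by apply: is_deriveD; apply: is_deriveZ.
by apply/funext => s; rewrite big_cons.
Qed.

Section Superposition.
Context {R : realType} {X : finType}.
Variables (Q : X -> X -> R) (pi : X -> R).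
Hypothesis chain : reversible_chain Q pi.
Implicit Types (r p : X -> R) (rho psi : R -> X -> R).

Let Q0 x y : 0 <= Q x y. Proof. exact: (rate_ge0 chain). Qed.
Let pi0 x : 0 < pi x. Proof. exact: (pi_gt0 chain). Qed.

Definition conductance r x y : R := logmean (r x) (r y) * Q x y * pi x.

Lemma conductanceC r x y : (forall x, 0 <= r x) ->
  conductance r x y = conductance r y x.
Proof.
by move=> r0; rewrite /conductance -!mulrA (pi_reversible chain) logmeanC.
Qed.

Lemma conductance_ge0 r x y : 0 <= conductance r x y.
Proof. by rewrite 2?mulr_ge0 ?logmean_ge0 ?Q0 ?ltW. Qed.

Lemma energyE r p :
  energy Q pi r p = 2^-1 * \sum_x \sum_y (p x - p y) ^+ 2 * conductance r x y.
Proof.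
rewrite /energy; congr (_ * _); apply: eq_bigr => x _; apply: eq_bigr => y _.
by rewrite /conductance !mulrA.
Qed.

Lemma pi_velocity r p x : pi x * velocity Q r p x = - laplacian (conductance r) p x.
Proof.
rewrite /velocity mulrN mulr_sumr; congr (- _); apply: eq_bigr => y _.
by rewrite /conductance; ring.
Qed.

Lemma conductance_superadditive (I : finType) (a : I -> R) (r : I -> X -> R) x y :
  (forall i, 0 <= a i) -> (forall i x, 0 <= r i x) ->
  \sum_i a i * conductance (r i) x y <= conductance (fun x => \sum_i a i * r i x) x y.
Proof.
move=> a0 r0; rewrite /conductance.
have -> : \sum_i a i * (logmean (r i x) (r i y) * Q x y * pi x) =
    (\sum_i logmean (a i * r i x) (a i * r i y)) * Q x y * pi x.
  by rewrite !mulr_suml; apply: eq_bigr => i _; rewrite logmeanZ// !mulrA.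
rewrite ler_wpM2r ?(ltW (pi0 _))// ler_wpM2r ?Q0//.
by apply: logmean_superadditive => i; rewrite mulr_ge0.
Qed.

Section Mixture.
Context {I : finType}.
Variables (a : I -> R) (r p : I -> X -> R).
Hypothesis a0 : forall i, 0 <= a i.
Hypothesis r0 : forall i x, 0 <= r i x.

Let w := conductance (fun x => \sum_i a i * r i x).

(** The potential which drives the average of the fluxes of the [p i] through
    the average density. *)
Definition mixture_potential : X -> R :=
  potential w (fun x => \sum_i a i * laplacian (conductance (r i)) (p i) x).

Let wC x y : w x y = w y x.
Proof. by apply: conductanceC => z; apply: sumr_ge0 => i _; rewrite mulr_ge0. Qed.

Let sum_parts u : \sum_x u x * (\sum_i a i * laplacian (conductance (r i)) (p i) x) =
  - (2^-1 * \sum_i \sum_x \sum_y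
       (u x - u y) * (p i x - p i y) * (a i * conductance (r i) x y)).
Proof.
under eq_bigr do rewrite mulr_sumr.
rewrite exchange_big/= mulr_sumr -sumrN; apply: eq_bigr => i _.
transitivity (a i * \sum_x u x * laplacian (conductance (r i)) (p i) x).
  by rewrite mulr_sumr; apply: eq_bigr => x _; rewrite mulrCA.
rewrite laplacian_parts; last by move=> x y; exact: conductanceC.
rewrite mulrN mulrCA; congr (- (_ * _)).
rewrite mulr_sumr; apply: eq_bigr => x _; rewrite mulr_sumr; apply: eq_bigr => y _.
by ring.
Qed.

Let le_w x y : \sum_i a i * conductance (r i) x y <= w x y.
Proof. exact: conductance_superadditive. Qed.

Let aw0 i x y : 0 <= a i * conductance (r i) x y.
Proof. by rewrite mulr_ge0 ?conductance_ge0. Qed.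

(** Edges without conductance for the average density have none for the
    components either, so the averaged source is balanced on components. *)
Lemma mixture_potentialP x : laplacian w mixture_potential x =
  \sum_i a i * laplacian (conductance (r i)) (p i) x.
Proof.
apply: laplacian_potential => //; first by move=> y z; exact: conductance_ge0.
move=> u cu; rewrite sum_parts big1 ?mulr0 ?oppr0// => i _.
apply: big1 => y _; apply: big1 => z _.
have [w0|/cu ->] := eqVneq (w y z) 0; last by rewrite subrr !mul0r.
have := le_w y z; rewrite w0 => h.
have /eqP : \sum_i a i * conductance (r i) y z = 0.
  by apply/eqP; rewrite eq_le h sumr_ge0.
rewrite psumr_eq0// => /allP/(_ i (mem_index_enum i))/= /eqP ->.
by rewrite mulr0.
Qed.

(** Testing the equation against the solution and using that the averaged
    conductances stay below those of the average density. *)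
Lemma mixture_energy_le :
  energy Q pi (fun x => \sum_i a i * r i x) mixture_potential <=
  \sum_i a i * energy Q pi (r i) (p i).
Proof.
set m := mixture_potential; rewrite energyE -/w.
set E := 2^-1 * _.
have EE : E = 2^-1 * \sum_i \sum_x \sum_y
       (m x - m y) * (p i x - p i y) * (a i * conductance (r i) x y).
  apply: oppr_inj; rewrite -sum_parts.
  under [RHS]eq_bigr do rewrite -mixture_potentialP.
  rewrite laplacian_parts// /E; congr (- (_ * _)).
pose F := 2^-1 * \sum_x \sum_y (m x - m y) ^+ 2 * \sum_i a i * conductance (r i) x y.
have FE : F <= E.
  rewrite /F /E ler_wpM2l ?invr_ge0 ?ler0n//; apply: ler_sum => x _; apply: ler_sum => y _.
  by rewrite ler_wpM2l ?sqr_ge0.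
have F2 : F = 2^-1 * \sum_i \sum_x \sum_y (m x - m y) ^+ 2 * (a i * conductance (r i) x y).
  congr (_ * _); rewrite [RHS]exchange_big/=; apply: eq_bigr => x _.
  by rewrite [RHS]exchange_big/=; apply: eq_bigr => y _; rewrite mulr_sumr.
suff : E <= 2^-1 * F + 2^-1 * \sum_i a i * energy Q pi (r i) (p i) by lra.
rewrite F2 EE mulrCA -mulrDr ler_wpM2l ?invr_ge0 ?ler0n//.
rewrite mulr_sumr -big_split/=; apply: ler_sum => i _.
rewrite energyE mulrCA -mulrDr mulr_sumr -big_split/= mulr_sumr; apply: ler_sum => x _.
rewrite mulr_sumr -big_split/= mulr_sumr; apply: ler_sum => y _.
have := aw0 i x y; set k := a i * conductance (r i) x y.
have -> : a i * ((p i x - p i y) ^+ 2 * conductance (r i) x y) =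
  (p i x - p i y) ^+ 2 * k by rewrite /k; ring.
have := sqr_ge0 ((m x - m y) - (p i x - p i y)).
by nra.
Qed.

Lemma mixture_velocity x :
  velocity Q (fun x => \sum_i a i * r i x) mixture_potential x =
  \sum_i a i * velocity Q (r i) (p i) x.
Proof.
apply: (mulfI (lt0r_neq0 (pi0 x))); rewrite pi_velocity mixture_potentialP.
by rewrite mulr_sumr -sumrN; apply: eq_bigr => i _; rewrite mulrCA pi_velocity mulrN.
Qed.

End Mixture.

(** Densities and fluxes are averaged at each time; the energy inequality of the
    mixture is integrated. *)
Lemma cost_le_convex (I : finType) (a c : I -> R) (r0 r1 : I -> X -> R) :
  (forall i, 0 <= a i) -> \sum_i a i = 1 ->
  (forall i, cost_le Q pi (r0 i) (r1 i) (c i)) ->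
  cost_le Q pi (fun x => \sum_i a i * r0 i x) (fun x => \sum_i a i * r1 i x)
    (\sum_i a i * c i).
Proof.
move=> a0 a1 /choice[rho_ /choice[psi_ /all_and2[adm le_c]]].
have ge0 i t x : 0 <= t <= 1 -> 0 <= rho_ i t x.
  by case: (adm i) => dr _ _ _ _ /dr[].
pose rho t x := \sum_i a i * rho_ i t x.
pose psi t := mixture_potential a (fun i => rho_ i t) (fun i => psi_ i t).
have mrho_ i x : measurable_fun (`[0, 1] : set R) (fun t => rho_ i t x).
  by apply: abs_continuous01_measurable; case: (adm i).
have ac_rho x : abs_continuous01 (fun t => rho t x).
  apply: abs_continuous01_sum => i; apply: abs_continuous01Z.
  by case: (adm i).
have mcond (r : R -> X -> R) x y : (forall x, measurable_fun (`[0, 1] : set R) (r ^~ x)) ->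
    (forall t x, 0 <= t <= 1 -> 0 <= r t x) ->
    measurable_fun (`[0, 1] : set R) (fun t => conductance (r t) x y).
  move=> mr r0'; do 2 apply: measurable_funM => //.
  by apply: measurable_logmean => // t; rewrite /= in_itv/= => t01; exact: r0'.
have rho0 t x : 0 <= t <= 1 -> 0 <= rho t x.
  by move=> t01; apply: sumr_ge0 => i _; rewrite mulr_ge0// ge0.
have admM : admissible Q pi (fun x => \sum_i a i * r0 i x) (fun x => \sum_i a i * r1 i x)
    rho psi.
  split.
  - move=> t t01; split; first by move=> x; exact: rho0.
    under eq_bigr do rewrite mulr_suml.
    rewrite exchange_big/= -[RHS]a1; apply: eq_bigr => i _.
    have [dr _ _ _ _] := adm i; have [_ d1] := dr t t01.
    by rewrite -[RHS]mulr1 -d1 mulr_sumr; apply: eq_bigr => x _; rewrite mulrA.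
  - by [].
  - split; apply/funext => x; apply: eq_bigr => i _; case: (adm i) => _ _ [].
      by move=> ->.
    by move=> _ ->.
  - move=> x; apply: measurable_potential => //.
      move=> y z; apply: mcond => [y'|t' x']; last exact: rho0.
      exact: abs_continuous01_measurable (ac_rho y').
    move=> y; apply: measurable_sum => i; apply: measurable_funM => //.
    apply: measurable_sum => z; apply: measurable_funM.
      by case: (adm i) => _ _ _ mp _; exact: measurable_funB.
    by apply: mcond => // t x'; exact: ge0.
  - have /ae_lebesgue_forall : forall i, {ae @lebesgue_measure R, forall t : R,
        0 <= t <= 1 -> forall x, is_derive t 1 (fun s : R => rho_ i s x)
          (velocity Q (rho_ i t) (psi_ i t) x)}.
      by move=> i; case: (adm i).
    apply: ae_lebesgueS => t h t01 x.
    rewrite -[X in is_derive _ _ _ X]/(velocity Q (rho t) (psi t) x).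
    rewrite mixture_velocity//; last by move=> i y; exact: ge0.
    by apply: is_derive_lincomb => i; exact: h.
exists rho, psi; split; first exact: admM.
rewrite (actionE chain admM).
have me i : measurable_fun (`[0, 1] : set R)
    (fun t => (energy Q pi (rho_ i t) (psi_ i t))%:E).
  by apply/measurable_EFinP; exact: (admissible_measurable (adm i)).
have m01 : measurable (`[0, 1]%classic : set R) by exact: measurable_itv.
have e0 i (t : R) : `[0, 1]%classic t -> (0 <= (energy Q pi (rho_ i t) (psi_ i t))%:E)%E.
  by move=> _; rewrite lee_fin energy_ge0.
have mae i : measurable_fun (`[0, 1] : set R)
    (fun t => (a i)%:E * (energy Q pi (rho_ i t) (psi_ i t))%:E)%E.
  by apply: emeasurable_funM; [exact: measurable_cst|exact: me].
apply: (@le_trans _ _ (\int[@lebesgue_measure R]_(t in `[0%R, 1%R])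
    (\sum_i (a i)%:E * (energy Q pi (rho_ i t) (psi_ i t))%:E))%E).
  apply: (ge0_le_integral (@lebesgue_measure R) m01).
  - by move=> t _; rewrite lee_fin energy_ge0.
  - by apply/measurable_EFinP; exact: (admissible_measurable admM).
  - by apply: emeasurable_sum => i; exact: mae.
  move=> t; rewrite /= in_itv/= => t01.
  under eq_bigr do rewrite -EFinM.
  rewrite sumEFin lee_fin; apply: mixture_energy_le => // i x; exact: ge0.
rewrite (ge0_integral_sum (@lebesgue_measure R) m01); last 2 first.
- by move=> i; exact: mae.
- by move=> i t _; rewrite -EFinM lee_fin mulr_ge0 ?energy_ge0.
rewrite -sumEFin; apply: lee_sum => i _.
rewrite (ge0_integralZl (@lebesgue_measure R) m01 (me i) (e0 i)) ?lee_fin// EFinM.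
by apply: lee_wpmul2l; rewrite ?lee_fin// -(actionE chain (adm i)).
Qed.

End Superposition.

(** * The transport metric under a diameter bound *)

Section Metric.
Context {R : realType} {X : finType}.
Variables (Q : X -> X -> R) (pi : X -> R).
Hypothesis chain : reversible_chain Q pi.
Implicit Types (r : X -> R).

Let pi0 x : 0 < pi x. Proof. exact: (pi_gt0 chain). Qed.

Definition dist r0 r1 : R := fine (transport_dist Q pi r0 r1).

Lemma dist_ge0 r0 r1 : 0 <= dist r0 r1.
Proof. by rewrite fine_ge0// sqrte_ge0. Qed.

Lemma transport_dist_le r0 r1 d : 0 <= d -> cost_le Q pi r0 r1 (d ^+ 2) ->
  (transport_dist Q pi r0 r1 <= d%:E)%E.
Proof.
move=> d0 [rho [psi [adm le]]].
have -> : d%:E = sqrte (d ^+ 2)%:E by rewrite /= sqrtr_sqr ger0_norm.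
rewrite lee_sqrt ?lee_fin ?sqr_ge0//; apply: le_trans le.
by apply: ereal_inf_lbound; exists rho, psi.
Qed.

Lemma cost_le_of_dist r0 r1 d : 0 <= d -> (transport_dist Q pi r0 r1 < d%:E)%E ->
  cost_le Q pi r0 r1 (d ^+ 2).
Proof.
move=> d0; have -> : d%:E = sqrte (d ^+ 2)%:E by rewrite /= sqrtr_sqr ger0_norm.
rewrite ltNge lee_sqrt; last first.
  apply/ereal_infP => _ [rho [psi [adm ->]]].
  rewrite (actionE chain adm); apply: integral_ge0 => t _.
  by rewrite lee_fin (energy_ge0 chain).
rewrite -ltNge => /ereal_inf_lt[_ [rho [psi [adm ->]]] /ltW le].
by exists rho, psi.
Qed.

Lemma transport_distE r0 r1 c : cost_le Q pi r0 r1 c ->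
  transport_dist Q pi r0 r1 = (dist r0 r1)%:E.
Proof.
move=> [rho [psi [adm le]]]; rewrite fineK// ge0_fin_numE ?sqrte_ge0//.
have : (transport_dist Q pi r0 r1 <= (Num.max 0 c + 1)%:E)%E.
  apply: transport_dist_le; first by rewrite addr_ge0// le_max lexx.
  exists rho, psi; split => //; apply: (le_trans le); rewrite lee_fin.
  have : 0 <= Num.max 0 c /\ c <= Num.max 0 c by rewrite !le_max !lexx orbT.
  by move=> [? ?]; nra.
by move=> /le_lt_trans; apply; rewrite ltry.
Qed.

Lemma dist_le r0 r1 d : 0 <= d -> cost_le Q pi r0 r1 (d ^+ 2) -> dist r0 r1 <= d.
Proof.
by move=> d0 h; rewrite -lee_fin -(transport_distE h); exact: transport_dist_le.
Qed.

Lemma dist_refl r : density pi r -> dist r r = 0.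
Proof.
move=> dr; apply/eqP; rewrite eq_le dist_ge0 andbT; apply: dist_le => //.
by rewrite expr0n; exact: cost_le_refl.
Qed.

Variable D : R.
Hypothesis D0 : 0 < D.
Hypothesis diamD : (diameter Q pi <= D%:E)%E.

Let cost_dirac x y :
  cost_le Q pi (dirac_density pi x) (dirac_density pi y) ((2 * D) ^+ 2).
Proof.
apply: cost_le_of_dist; first by rewrite mulr_ge0 ?ler0n// ltW.
apply: (@le_lt_trans _ _ D%:E); last by rewrite lte_fin ltr_pMl ?ltr1n.
by apply: le_trans diamD; apply: ereal_sup_ubound; exists (x, y).
Qed.

Lemma dirac_densityP x : density pi (dirac_density pi x).
Proof.
split=> [y|]; first by rewrite divr_ge0 ?ler0n// ltW.
rewrite (bigD1 x)//= big1 ?addr0 => [|y /negbTE yx].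
  by rewrite /dirac_density eqxx mul1r mulVf// gt_eqF.
by rewrite /dirac_density yx !mul0r.
Qed.

(** Couple the two densities so that their common part does not move, and
    superpose the curves joining the Dirac masses that do. *)
Lemma cost_le_coupling r s : density pi r -> density pi s ->
  cost_le Q pi r s ((2 * D) ^+ 2 * \sum_x (r x * pi x - Num.min (r x * pi x) (s x * pi x))).
Proof.
move=> [r0 r1] [s0 s1].
pose p x := r x * pi x; pose q x := s x * pi x; pose m x := Num.min (p x) (q x).
pose u x := p x - m x; pose v x := q x - m x; pose e := \sum_x u x.
have p0 x : 0 <= p x by rewrite mulr_ge0 ?r0// ltW.
have q0 x : 0 <= q x by rewrite mulr_ge0 ?s0// ltW.
have m0 x : 0 <= m x by rewrite le_min p0 q0.
have u0 x : 0 <= u x by rewrite subr_ge0 ge_min lexx.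
have v0 x : 0 <= v x by rewrite subr_ge0 ge_min lexx orbT.
have e0 : 0 <= e by apply: sumr_ge0.
have ve : \sum_x v x = e by rewrite /e !sumrB r1 s1.
have kill (f : X -> R) x : (forall x, 0 <= f x) -> \sum_x f x = e ->
    f x / e * e = f x.
  move=> f0 fe; have [e00|en0] := eqVneq e 0; last by rewrite divfK.
  rewrite e00 mulr0; apply/esym/eqP; move: fe; rewrite e00 => /eqP.
  by rewrite psumr_eq0// => /allP/(_ x (mem_index_enum x)).
pose c x y := (x == y)%:R * m x + u x * v y / e.
have c0 x y : 0 <= c x y by rewrite addr_ge0 ?mulr_ge0 ?invr_ge0 ?ler0n.
have cl x : \sum_y c x y = p x.
  rewrite big_split/= (bigD1 x)//= eqxx mul1r [X in _ + X + _]big1 => [|y]; last first.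
    by rewrite eq_sym => /negbTE ->; rewrite mul0r.
  rewrite addr0; under eq_bigr do rewrite mulrAC.
  by rewrite -mulr_sumr ve kill// /u subrKC.
have cr y : \sum_x c x y = q y.
  rewrite big_split/= (bigD1 y)//= eqxx mul1r [X in _ + X + _]big1 => [|x]; last first.
    by move=> /negbTE ->; rewrite mul0r.
  rewrite addr0; under eq_bigr do rewrite -mulrA.
  by rewrite -mulr_suml mulrC kill// /v subrKC.
have c1 : \sum_xy c xy.1 xy.2 = 1.
  by rewrite -(pair_bigA _ c) -r1; apply: eq_bigr => x _; rewrite cl.
have H (xy : X * X) : cost_le Q pi (dirac_density pi xy.1) (dirac_density pi xy.2)
    (if xy.1 == xy.2 then 0 else (2 * D) ^+ 2).
  case: ifPn => [/eqP ->|_]; last exact: cost_dirac.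
  exact: (cost_le_refl chain (dirac_densityP _)).
have := cost_le_convex chain (fun xy => c0 xy.1 xy.2) c1 H.
have -> : (fun x => \sum_xy c xy.1 xy.2 * dirac_density pi xy.1 x) = r.
  apply/funext => z; rewrite -(pair_bigA _ (fun x y => c x y * dirac_density pi x z)).
  under eq_bigr do rewrite -mulr_suml cl.
  rewrite (bigD1 z)//= big1 ?addr0 => [|x /negbTE xz].
    by rewrite /dirac_density eqxx mul1r mulfK// gt_eqF.
  by rewrite /dirac_density eq_sym xz mul0r mulr0.
have -> : (fun x => \sum_xy c xy.1 xy.2 * dirac_density pi xy.2 x) = s.
  apply/funext => z; rewrite -(pair_bigA _ (fun x y => c x y * dirac_density pi y z)).
  rewrite exchange_big/=; under eq_bigr do rewrite -mulr_suml cr.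
  rewrite (bigD1 z)//= big1 ?addr0 => [|x /negbTE xz].
    by rewrite /dirac_density eqxx mul1r mulfK// gt_eqF.
  by rewrite /dirac_density eq_sym xz mul0r mulr0.
apply: cost_leW.
have -> : (2 * D) ^+ 2 * e = \sum_xy u xy.1 * v xy.2 / e * (2 * D) ^+ 2.
  rewrite -(pair_bigA _ (fun x y => u x * v y / e * (2 * D) ^+ 2)).
  rewrite mulrC mulr_suml; apply: eq_bigr => x _.
  rewrite -mulr_suml; congr (_ * _); under eq_bigr do rewrite mulrAC.
  by rewrite -mulr_sumr ve kill.
apply: ler_sum => xy _; case: ifPn => [_|/negbTE xy0].
  by rewrite mulr0 mulr_ge0 ?sqr_ge0// mulr_ge0 ?invr_ge0// mulr_ge0.
by rewrite /c xy0 mul0r add0r.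
Qed.

Lemma cost_le_density r s : density pi r -> density pi s ->
  cost_le Q pi r s ((2 * D) ^+ 2).
Proof.
move=> dr ds; apply: cost_leW (cost_le_coupling dr ds).
rewrite ler_piMr ?sqr_ge0//; case: dr => r0 <-; case: ds => s0 _.
by apply: ler_sum => x _; rewrite gerBl le_min !mulr_ge0 ?r0 ?s0 ?ltW.
Qed.

Lemma dist_fin r s : density pi r -> density pi s ->
  transport_dist Q pi r s = (dist r s)%:E.
Proof. by move=> dr ds; exact: transport_distE (cost_le_density dr ds). Qed.

Lemma cost_le_dist r s d : density pi r -> density pi s -> dist r s < d ->
  cost_le Q pi r s (d ^+ 2).
Proof.
move=> dr ds rsd; apply: cost_le_of_dist.
  by rewrite (le_trans (dist_ge0 _ _) (ltW rsd)).
by rewrite dist_fin// lte_fin.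
Qed.

Lemma dist_le_diam r s : density pi r -> density pi s -> dist r s <= 2 * D.
Proof.
move=> dr ds; apply: dist_le; first by rewrite mulr_ge0 ?ler0n// ltW.
exact: cost_le_density.
Qed.

Lemma dist_sym r s : density pi r -> density pi s -> dist r s = dist s r.
Proof.
suff H r' s' : density pi r' -> density pi s' -> dist r' s' <= dist s' r'.
  by move=> dr ds; apply/eqP; rewrite eq_le !H.
move=> dr ds; apply/ler_addgt0Pr => e e0.
apply: dist_le; first by rewrite addr_ge0 ?dist_ge0// ltW.
by apply: cost_le_sym => //; apply: cost_le_dist => //; rewrite ltrDl.
Qed.

(** Dividing the time in proportion to the two lengths makes the action of the
    concatenation the square of their sum. *)
Lemma dist_triangle r s t : density pi r -> density pi s -> density pi t ->
  dist r t <= dist r s + dist s t.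
Proof.
move=> dr ds dt; apply/ler_addgt0Pr => e e0.
pose a := dist r s + e / 2; pose b := dist s t + e / 2.
have e20 : 0 < e / 2 by rewrite divr_gt0.
have a0 : 0 < a by rewrite ltr_wpDl// dist_ge0.
have b0 : 0 < b by rewrite ltr_wpDl// dist_ge0.
have -> : dist r s + dist s t + e = a + b by rewrite /a /b; lra.
apply: dist_le; first by rewrite addr_ge0// ltW.
have ca : cost_le Q pi r s (a ^+ 2) by apply: cost_le_dist => //; rewrite ltrDl.
have cb : cost_le Q pi s t (b ^+ 2) by apply: cost_le_dist => //; rewrite ltrDl.
have ab0 : 0 < a + b by rewrite addr_gt0.
have c01 : 0 < a / (a + b) < 1.
  by rewrite divr_gt0//= ltr_pdivrMr// mul1r ltrDl.
have := cost_le_concat chain c01 ca cb.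
rewrite (_ : a ^+ 2 / _ + _ = (a + b) ^+ 2)//.
by field; rewrite !gt_eqF//= (_ : a + b - a = b) ?gt_eqF//; ring.
Qed.

Lemma dist_tv r s : density pi r -> density pi s ->
  dist r s ^+ 2 <= (2 * D) ^+ 2 * \sum_x `|r x - s x| * pi x.
Proof.
move=> dr ds; set S := \sum_x _.
have S0 : 0 <= S by apply: sumr_ge0 => x _; rewrite mulr_ge0// ltW.
have K0 : 0 <= (2 * D) ^+ 2 * S by rewrite mulr_ge0// sqr_ge0.
rewrite -[leRHS]sqr_sqrtr//.
rewrite ler_pXn2r ?nnegrE ?sqrtr_ge0 ?dist_ge0//.
apply: dist_le; rewrite ?sqrtr_ge0// sqr_sqrtr//.
apply: cost_leW (cost_le_coupling dr ds); rewrite ler_wpM2l ?sqr_ge0//.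
apply: ler_sum => x _; have := ltW (pi0 x) => px0.
rewrite -[X in _ <= _ * X](gtr0_norm (pi0 x)) -normrM mulrBl.
case: (leP (r x * pi x) (s x * pi x)) => _; last by rewrite ler_norm.
by rewrite subrr.
Qed.

End Metric.

(** * Existence of geodesics *)

(** Along an ultrafilter all bounded sequences converge, such as those of all
    values of a sequence of curves at all times. *)
Lemma ultra_cvg_bounded (R : realType) (U : set_system nat) (f : nat -> R) (M : R) :
  UltraFilter U -> (forall n, 0 <= f n <= M) -> exists l : R, f @ U --> l.
Proof.
move=> UU fM; have UP := @ultra_proper _ _ UU.
have FP : ProperFilter (f @ U) by exact: fmap_proper_filter.
have FA : U (f @^-1` `[0, M]%classic).
  by apply: filterS filterT => n _; rewrite /= in_itv/=; exact: fM.
have [l [_ cl]] := @segment_compact R 0 M (f @ U) FP FA.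
exists l => V Vl; rewrite /= /fmap/=.
have [//|nV] := in_ultra_setVsetC (f @^-1` V) UU.
have [y [nVy Vy]] := cl (~` V) V nV Vl.
by case: nVy.
Qed.

Lemma cvgr_sum (R : realType) (T : Type) (F : set_system T) (FF : Filter F)
    (I : finType) (f : I -> T -> R) (l : I -> R) :
  (forall i, f i @ F --> l i) -> (fun t => \sum_i f i t) @ F --> \sum_i l i.
Proof. by move=> fl; apply: cvg_big => [|i _]; [exact: add_continuous|exact: fl]. Qed.

Section Geodesics.
Context {R : realType} {X : finType}.
Variables (Q : X -> X -> R) (pi : X -> R).
Hypothesis chain : reversible_chain Q pi.
Implicit Types (r : X -> R).

Let pi0 x : 0 < pi x. Proof. exact: (pi_gt0 chain). Qed.

Variable D : R.
Hypothesis D0 : 0 < D.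
Hypothesis diamD : (diameter Q pi <= D%:E)%E.

Local Notation dist := (dist Q pi).

(** The three pieces cut by two times have actions whose sum is almost the
    squared distance of the end points, while their lengths add up to at least
    that distance: equality is almost achieved in the Cauchy-Schwarz
    inequality. *)
Lemma almost_geodesic r0 r1 (e : R) : density pi r0 -> density pi r1 -> 0 < e ->
  exists mu : R -> X -> R,
    [/\ forall t, 0 <= t <= 1 -> density pi (mu t), mu 0 = r0, mu 1 = r1 &
        forall s t, 0 <= s -> s <= t -> t <= 1 ->
          (dist (mu s) (mu t) - (t - s) * dist r0 r1) ^+ 2 <= e].
Proof.
move=> dr0 dr1 e0; set W := dist r0 r1.
have W0 : 0 <= W by exact: dist_ge0.
have We0 : 0 <= W ^+ 2 + e by rewrite addr_ge0 ?sqr_ge0// ltW.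
have : cost_le Q pi r0 r1 (W ^+ 2 + e).
  rewrite -(sqr_sqrtr We0); apply: (cost_le_dist chain D0 diamD) => //.
  rewrite -/W -{1}(ger0_norm W0) -sqrtr_sqr ltr_sqrt ?ltrDl//.
  by rewrite ltr_wpDl// sqr_ge0.
move=> [rho [psi [adm le]]]; have [dr _ [rho0 rho1] _ _] := adm.
exists rho; split => //.
pose f t := energy Q pi (rho t) (psi t).
have f0 t : 0 <= f t by exact: (energy_ge0 chain).
have If : (@lebesgue_measure R).-integrable `[0, 1] (EFin \o f).
  apply/integrableP; split.
    by apply/measurable_EFinP; exact: (admissible_measurable adm).
  apply: (le_lt_trans _ (ltry (W ^+ 2 + e))).
  rewrite (_ : integral _ _ _ = action Q pi rho psi)//.
  rewrite (actionE chain adm); apply: eq_integral => t _ /=.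
  by rewrite ger0_norm.
have IfS (i : interval R) : [set` i] `<=` (`[0, 1]%classic : set R) ->
    (@lebesgue_measure R).-integrable [set` i] (EFin \o f).
  by move=> i01; apply: (integrableS _ _ _ If) => //; exact: measurable_itv.
pose B u v := \int[@lebesgue_measure R]_(t in `]u, v]) f t.
have BD u v w : 0 <= u -> u <= v -> v <= w -> w <= 1 -> B u w = B u v + B v w.
  move=> u0 uv vw w1; rewrite /B -(@Rintegral_itvB _ f (BRight u) (BRight w) v).
  - by rewrite subrKC.
  - apply: IfS => t; rewrite /= !in_itv/= => /andP[/ltW ut tw].
    by rewrite (le_trans u0)//= (le_trans tw).
  - by rewrite bnd_simp.
  - by rewrite bnd_simp.
have B0 u v : 0 <= B u v by apply: Rintegral_ge0.
have B01 : B 0 1 <= W ^+ 2 + e.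
  rewrite /B Rintegral_itv_obnd_cbnd; last first.
    by apply: IfS => t; rewrite /= !in_itv/= => /andP[/ltW -> ->].
  move: le; rewrite (actionE chain adm) => le.
  rewrite -lee_fin; apply: le_trans le.
  rewrite /Rintegral fineK//.
  by apply: integrable_fin_num => //; exact: measurable_itv.
have piece s t : 0 <= s -> s <= t -> t <= 1 ->
    dist (rho s) (rho t) ^+ 2 <= (t - s) * B s t.
  move=> s0 st t1; have s01 : 0 <= s <= 1 by rewrite s0 (le_trans st).
  have t01 : 0 <= t <= 1 by rewrite t1 (le_trans s0).
  have [<-|nst] := eqVneq s t.
    by rewrite (dist_refl chain (dr _ s01)) expr0n/= subrr mul0r.
  have [adm' actE] := admissible_affine chain adm s01 t01 nst.
  have K0 : 0 <= (t - s) * B s t by rewrite mulr_ge0// subr_ge0.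
  rewrite -(sqr_sqrtr K0) ler_pXn2r ?nnegrE ?sqrtr_ge0 ?dist_ge0//.
  apply: dist_le; rewrite ?sqrtr_ge0// sqr_sqrtr//.
  eexists; eexists; split; first exact: adm'.
  rewrite actE (min_idPl st) (max_idPr st) ger0_norm ?subr_ge0// EFinM.
  apply: lee_wpmul2l; first by rewrite lee_fin subr_ge0.
  rewrite /B Rintegral_itv_obnd_cbnd; last first.
    apply: IfS => u; rewrite /= !in_itv/= => /andP[/ltW su ut].
    by rewrite (le_trans s0 su) (le_trans ut t1).
  rewrite /Rintegral fineK; first exact: lexx.
  apply: integrable_fin_num; first exact: measurable_itv.
  apply: IfS => u; rewrite /= !in_itv/= => /andP[su ut].
  by rewrite (le_trans s0 su) (le_trans ut t1).
move=> s t s0 st t1.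
have s1 := le_trans st t1; have t0 := le_trans s0 st.
have dens u : 0 <= u -> u <= 1 -> density pi (rho u) by move=> ? ?; apply/dr/andP.
have Ba := piece 0 s (lexx 0) s0 s1; have Bb := piece s t s0 st t1.
have Bc := piece t 1 t0 t1 (lexx 1).
have Bsum : B 0 s + B s t + B t 1 <= W ^+ 2 + e.
  by rewrite -addrA -BD// -BD.
have tri : W <= dist (rho 0) (rho s) + dist (rho s) (rho t) + dist (rho t) (rho 1).
  rewrite /W -rho0 -rho1.
  have h1 := dist_triangle chain D0 diamD (dens _ (lexx 0) ler01) (dens _ s0 s1)
    (dens _ ler01 (lexx 1)).
  have h2 := dist_triangle chain D0 diamD (dens _ s0 s1) (dens _ t0 t1) (dens _ ler01 (lexx 1)).
  by lra.
have := (B0 0 s, B0 s t, B0 t 1); move: Ba Bb Bc Bsum tri.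
rewrite subr0; set a := dist _ _; set b := dist _ _; set c := dist _ _.
move: (B 0 s) (B s t) (B t 1) => A1 A2 A3 Ba Bb Bc Bsum tri [[A10 A20] A30].
(* 2 W a - s W^2 <= a^2 / s, in a form that allows s = 0 *)
have tangent l x y : 0 <= l -> 0 <= y -> x ^+ 2 <= l * y -> 2 * W * x - l * W ^+ 2 <= y.
  rewrite le_eqVlt => /predU1P[<- y0|l0 y0 xly].
    rewrite !mul0r subr0 => x2; have -> : x = 0.
      by apply/eqP; rewrite -sqrf_eq0 eq_le x2 sqr_ge0.
    by rewrite mulr0.
  rewrite -(ler_pM2l l0); have := sqr_ge0 (x - l * W); nra.
have ta := tangent _ _ _ s0 A10 Ba.
have tc : 2 * W * c - (1 - t) * W ^+ 2 <= A3 by apply: tangent => //; rewrite subr_ge0.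
have l0 : 0 <= t - s by rewrite subr_ge0.
have WW : W * W <= W * (a + b + c) by rewrite ler_wpM2l.
have A2le : A2 <= e + 2 * W * b - (t - s) * W ^+ 2 by nra.
have : b ^+ 2 <= (t - s) * (e + 2 * W * b - (t - s) * W ^+ 2).
  by apply: (le_trans Bb); rewrite ler_wpM2l.
have le1 : (t - s) * e <= e by rewrite ler_piMl ?(ltW e0)//; lra.
by nra.
Qed.

(** The almost geodesics converge pointwise along an ultrafilter, and the
    distance, being controlled by the total variation, passes to the limit. *)
Lemma exists_geodesic r0 r1 : density pi r0 -> density pi r1 ->
  exists g : R -> X -> R, [/\ geodesic Q pi g, g 0 = r0 & g 1 = r1].
Proof.
move=> dr0 dr1; set W := dist r0 r1.
have /choice[mu muP] : forall n : nat, exists mu : R -> X -> R,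
    [/\ forall t, 0 <= t <= 1 -> density pi (mu t), mu 0 = r0, mu 1 = r1 &
        forall s t, 0 <= s -> s <= t -> t <= 1 ->
          (dist (mu s) (mu t) - (t - s) * W) ^+ 2 <= n.+1%:R^-1].
  by move=> n; apply: almost_geodesic.
have [U [UU UN]] := @ultraFilterLemma nat \oo eventually_filter.
have UP := @ultra_proper _ _ UU.
have bnd t x n : 0 <= t <= 1 -> 0 <= mu n t x <= (pi x)^-1.
  have [dn _ _ _] := muP n; move=> /dn[d0 d1]; rewrite d0/=.
  rewrite -[leRHS]mul1r ler_pdivlMr// -d1 (bigD1 x)//= lerDl sumr_ge0// => y _.
  by rewrite mulr_ge0 ?d0// ltW.
have /choice[g gP] : forall tx : R * X, exists l : R, 0 <= tx.1 <= 1 ->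
    (fun n => mu n tx.1 tx.2) @ U --> l.
  move=> [t x]; have [t01|nt] := pselect (0 <= t <= 1); last by exists 0.
  have [l ml] := ultra_cvg_bounded UU (fun n => bnd t x n t01).
  by exists l => _; exact: ml.
pose h t x := g (t, x).
have hP t x : 0 <= t <= 1 -> (fun n => mu n t x) @ U --> h t x by exact: (gP (t, x)).
have dh t : 0 <= t <= 1 -> density pi (h t).
  move=> t01; split=> [x|].
    rewrite -(cvg_lim (@Rhausdorff R) (hP t x t01)); apply: limr_ge.
      by apply/cvg_ex; exists (h t x); exact: hP.
    by apply: nearW => n; case/andP: (bnd t x n t01).
  have c1 : (fun n => \sum_x mu n t x * pi x) @ U --> \sum_x h t x * pi x.
    apply: cvgr_sum => x; apply: cvgM; [exact: hP|exact: cvg_cst].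
  apply: (cvg_unique (@Rhausdorff R) c1).
  rewrite (_ : (fun n => _) = cst 1); first exact: cvg_cst.
  by apply/funext => n /=; have [dn _ _ _] := muP n; case: (dn t t01).
have h0 : h 0 = r0.
  apply/funext => x; apply: (cvg_unique (@Rhausdorff R) (hP 0 x _)); first by rewrite lexx ler01.
  rewrite (_ : (fun n => _) = cst (r0 x)); first exact: cvg_cst.
  by apply/funext => n; have [_ -> _ _] := muP n.
have h1 : h 1 = r1.
  apply/funext => x; apply: (cvg_unique (@Rhausdorff R) (hP 1 x _)); first by rewrite lexx ler01.
  rewrite (_ : (fun n => _) = cst (r1 x)); first exact: cvg_cst.
  by apply/funext => n; have [_ _ -> _] := muP n.
have close t e : 0 <= t <= 1 -> 0 < e -> \forall n \near U, dist (mu n t) (h t) < e.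
  move=> t01 e0; have K0 : 0 < (2 * D) ^+ 2 by rewrite exprn_gt0// mulr_gt0.
  have c0 : (fun n => \sum_x `|mu n t x - h t x| * pi x) @ U --> \sum_(x : X) (0 : R).
    apply: cvgr_sum => x; rewrite -[X in _ --> X](mul0r (pi x)).
    apply: cvgM; last exact: cvg_cst.
    rewrite -[X in _ --> X](@normr0 _ R) -(subrr (h t x)).
    exact: cvg_norm (cvgB (hP t x t01) (cvg_cst (h t x))).
  rewrite big1 ?sumr_const// in c0.
  have ee : 0 < e ^+ 2 / (2 * D) ^+ 2 by rewrite divr_gt0// exprn_gt0.
  have FU : Filter U by exact: filter_filter.
  apply: (@filterS _ U FU _ _ _ (cvgr_lt _ c0 _ ee)) => n hn.
  have [dn _ _ _] := muP n.
  rewrite -(ltr_pXn2r (n := 2)) ?nnegrE ?dist_ge0 ?(ltW e0)//.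
  apply: (le_lt_trans (dist_tv chain D0 diamD (dn _ t01) (dh _ t01))).
  by rewrite mulrC -ltr_pdivlMr.
have key s t : 0 <= s -> s <= t -> t <= 1 -> dist (h s) (h t) = (t - s) * W.
  move=> s0 st t1.
  have s01 : 0 <= s <= 1 by rewrite s0 (le_trans st).
  have t01 : 0 <= t <= 1 by rewrite t1 (le_trans s0).
  apply/eqP; rewrite -subr_eq0 -normr_le0; apply/ler_addgt0Pr => e e0; rewrite add0r.
  have e30 : 0 < e / 3 by rewrite divr_gt0.
  have e230 : 0 < (e / 3) ^+ 2 by rewrite exprn_gt0.
  have [n [[n1 n2] n3]] : exists n, (dist (mu n s) (h s) < e / 3 /\ dist (mu n t) (h t) < e / 3) /\
      n.+1%:R^-1 < (e / 3) ^+ 2.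
    apply: (@filter_ex _ U); apply: filterI; last first.
      by apply: UN; exact: near_infty_natSinv_lt (PosNum e230).
    by apply: filterI; exact: close.
  have [dn _ _ mn] := muP n.
  have n4 : `|dist (mu n s) (mu n t) - (t - s) * W| < e / 3.
    rewrite -(ltr_pXn2r (n := 2)) ?nnegrE ?(ltW e30)// real_normK ?num_real//.
    exact: le_lt_trans (mn s t s0 st t1) n3.
  have T := dist_triangle chain D0 diamD.
  have S := dist_sym chain D0 diamD.
  have := T _ _ _ (dh _ s01) (dn _ s01) (dh _ t01).
  have := T _ _ _ (dn _ s01) (dn _ t01) (dh _ t01).
  have := T _ _ _ (dn _ s01) (dh _ s01) (dn _ t01).
  have := T _ _ _ (dh _ s01) (dh _ t01) (dn _ t01).
  rewrite (S _ _ (dh _ s01) (dn _ s01)) (S _ _ (dh _ t01) (dn _ t01)).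
  move: n4; rewrite !ltr_norml ler_norml => /andP[? ?] ? ? ? ?.
  by apply/andP; split; lra.
exists h; split => //; split => // s t s01 t01.
have d0 : density pi (h 0) by apply: dh; rewrite lexx ler01.
have d1 : density pi (h 1) by apply: dh; rewrite lexx ler01.
rewrite !(dist_fin chain D0 diamD)//; try exact: dh.
rewrite -EFinM h0 h1 -/W; congr EFin.
have [/andP[s0 s1] /andP[t0 t1]] := (s01, t01).
have [st|/ltW ts] := leP s t.
  by rewrite key// distrC ger0_norm// subr_ge0.
rewrite (dist_sym chain D0 diamD); try exact: dh.
by rewrite key// ger0_norm// subr_ge0.
Qed.

End Geodesics.

(** * Entropy against distance and Fisher information *)

Lemma xlnx_le_tangent (R : realType) (a b : R) : 0 < a -> 0 <= b ->
  a * ln a - b * ln b <= ln a * (a - b) + (a - b).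
Proof.
move=> a0; rewrite le_eqVlt => /predU1P[<-|b0].
  by rewrite mul0r !subr0 mulrC lerDl ltW.
have h : ln (a / b) <= a / b - 1.
  by rewrite -{1}(subrKC 1 (a / b)) le_ln1Dx// ltrBrDl subrr divr_gt0.
have : b * ln (a / b) <= b * (a / b - 1) by rewrite ler_wpM2l// ltW.
rewrite lnM ?posrE ?invr_gt0// lnV ?posrE// !mulrBr mulr1 mulrCA divff ?gt_eqF// mulr1.
by move=> ?; lra.
Qed.

Section HWI.
Context {R : realType} {X : finType}.
Variables (Q : X -> X -> R) (pi : X -> R).
Hypothesis chain : reversible_chain Q pi.
Implicit Types (r : X -> R).

Let Q0 x y : 0 <= Q x y. Proof. exact: (rate_ge0 chain). Qed.
Let pi0 x : 0 < pi x. Proof. exact: (pi_gt0 chain). Qed.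

(** The Fisher information, the rate at which the heat flow started at [r]
    dissipates entropy. *)
Definition fisher r : R :=
  2^-1 * \sum_x \sum_y (ln (r x) - ln (r y)) * (r x - r y) * Q x y * pi x.

Let density_le r x : density pi r -> r x <= (pi x)^-1.
Proof.
move=> [r0 r1]; rewrite -[leRHS]mul1r ler_pdivlMr// -r1 (bigD1 x)//= lerDl sumr_ge0// => y _.
by rewrite mulr_ge0// ltW.
Qed.

(** The speed of the functional is integrated in time. Bounds affine in the
    energy are what the inequality of the two means provides, and they
    integrate to bounds by the action. *)
Lemma curve_linear_bound r0 r1 rho psi (l : X -> R) (A B c : R) :
  admissible Q pi r0 r1 rho psi -> (action Q pi rho psi <= (c ^+ 2)%:E)%E ->
  0 <= A -> 0 <= B ->
  (forall t, 0 <= t <= 1 -> `|\sum_x l x * velocity Q (rho t) (psi t) x| <=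
     A + B * energy Q pi (rho t) (psi t)) ->
  forall t, 0 <= t <= 1 ->
  `|\sum_x l x * rho t x - \sum_x l x * r0 x| <= A + B * c ^+ 2.
Proof.
move=> adm le A0 B0 hv t t01; have [_ ac [E0 _] _ ode] := adm.
pose f t := energy Q pi (rho t) (psi t).
have f0 s : 0 <= f s by exact: (energy_ge0 chain).
have mf : measurable_fun (`[0, 1] : set R) f by exact: (admissible_measurable adm).
have mE : measurable (`[0, 1]%classic : set R) by exact: measurable_itv.
have If : (@lebesgue_measure R).-integrable `[0, 1] (EFin \o f).
  apply/integrableP; split; first by apply/measurable_EFinP.
  apply: (le_lt_trans _ (ltry (c ^+ 2))); apply: le_trans le.
  rewrite (actionE chain adm) le_eqVlt; apply/orP; left; apply/eqP.
  by apply: eq_integral => s _ /=; rewrite ger0_norm.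
have IA : (@lebesgue_measure R).-integrable `[0, 1] (EFin \o (fun=> A)).
  apply: measurable_bounded_integrable => //; first exact: lebesgue01_lty.
  by exists `|A|; split => // x /ltW Ax s _.
have IBf : (@lebesgue_measure R).-integrable `[0, 1] (EFin \o (fun s => B * f s)).
  rewrite (_ : EFin \o _ = fun s => (B%:E * (EFin \o f) s)%E)//.
  exact: integrableZl.
have Ig : (@lebesgue_measure R).-integrable `[0, 1] (EFin \o (fun s => A + B * f s)).
  rewrite (_ : EFin \o _ = (EFin \o (fun=> A)) \+ (EFin \o (fun s => (B * f s)%R)))%E//.
  exact: integrableD.
have := @abs_continuous01_dist_le _ (fun s => \sum_x l x * rho s x)
   (fun s => A + B * f s) _ Ig _ _ t t01.
rewrite E0 => h; apply: (le_trans (h _ _ _)).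
- by apply: abs_continuous01_sum => x; apply: abs_continuous01Z; exact: ac.
- apply: ae_lebesgueS ode => s hs s01.
  exists (\sum_x l x * velocity Q (rho s) (psi s) x); last exact: hv.
  by apply: is_derive_lincomb => x; exact: hs.
- by move=> s _; rewrite addr_ge0// mulr_ge0.
rewrite (RintegralD _ IA IBf)// Rintegral01_cst lerD2l (RintegralZl _ _ If)//.
rewrite ler_wpM2l// -lee_fin; apply: le_trans le; rewrite (actionE chain adm).
rewrite /Rintegral fineK; first exact: lexx.
exact: integrable_fin_num.
Qed.

(** Logarithmic means of densities are bounded by a constant of the chain, so
    the energy controls the velocity at every point. *)
Lemma curve_displacement : exists2 K : R, 0 < K & forall r0 r1 rho psi c, 0 < c ->
  admissible Q pi r0 r1 rho psi -> (action Q pi rho psi <= (c ^+ 2)%:E)%E ->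
  forall t x, 0 <= t <= 1 -> `|rho t x - r0 x| <= K * c.
Proof.
pose M x := \sum_y ((pi x)^-1 + (pi y)^-1) * Q x y.
have M0 x : 0 <= M x.
  by apply: sumr_ge0 => y _; rewrite mulr_ge0// addr_ge0// invr_ge0 ltW.
have ipi0 x : 0 < (pi x)^-1 by rewrite invr_gt0.
exists (1 + \sum_x (M x + (pi x)^-1)).
  by rewrite ltr_wpDr// sumr_ge0// => x _; rewrite addr_ge0// ltW.
move=> r0 r1 rho psi c c0 adm le t x t01; have [dr _ _ _ _] := adm.
pose l y : R := (y == x)%:R.
have lE (f : X -> R) : \sum_y l y * f y = f x.
  rewrite (bigD1 x)//= /l eqxx mul1r big1 ?addr0// => y /negbTE ->.
  by rewrite mul0r.
apply: (@le_trans _ _ (2^-1 * c * M x + (c * pi x)^-1 * c ^+ 2)); last first.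
  have -> : (c * pi x)^-1 * c ^+ 2 = c * (pi x)^-1 by field; rewrite !gt_eqF.
  rewrite mulrDl mul1r mulr_suml (bigD1 x)//=.
  have : 0 <= \sum_(i | i != x) (M i + (pi i)^-1) * c.
    by apply: sumr_ge0 => y _; rewrite mulr_ge0 ?(ltW c0)// addr_ge0// ltW.
  have : 0 <= c * M x by rewrite mulr_ge0// ltW.
  by move=> ? ?; lra.
rewrite -(lE (rho t)) -(lE r0).
apply: (curve_linear_bound adm le) => //.
- by rewrite mulr_ge0// mulr_ge0 ?invr_ge0 ?ler0n// ltW.
- by rewrite invr_ge0 mulr_ge0// ltW.
move=> s s01; rewrite lE /velocity normrN; have [rs0 _] := dr s s01.
apply: (le_trans (ler_norm_sum _ _ _)).
pose th y := logmean (rho s x) (rho s y) * Q x y.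
have th0 y : 0 <= th y by rewrite mulr_ge0 ?logmean_ge0.
apply: (@le_trans _ _ (\sum_y (2^-1 * c * th y +
    (2 * c)^-1 * ((psi s x - psi s y) ^+ 2 * th y)))).
  apply: ler_sum => y _; rewrite -mulrA normrM (ger0_norm (th0 y)).
  set d := psi s y - psi s x.
  have -> : (psi s x - psi s y) ^+ 2 = `|d| ^+ 2 by rewrite real_normK ?num_real// /d; ring.
  have -> : 2^-1 * c * th y + (2 * c)^-1 * (`|d| ^+ 2 * th y) =
      th y * (2^-1 * c^-1 * (c ^+ 2 + `|d| ^+ 2)) by field; rewrite gt_eqF.
  rewrite mulrC ler_wpM2l//.
  rewrite -(ler_pM2l c0).
  have -> : c * (2^-1 * c^-1 * (c ^+ 2 + `|d| ^+ 2)) = 2^-1 * (c ^+ 2 + `|d| ^+ 2).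
    by field; rewrite gt_eqF.
  by have := sqr_ge0 (c - `|d|); lra.
rewrite big_split/= -!mulr_sumr; apply: lerD.
  rewrite ler_wpM2l// ?mulr_ge0 ?invr_ge0 ?ler0n ?(ltW c0)//.
  apply: ler_sum => y _; rewrite ler_wpM2r//.
  apply: (le_trans (logmean_le_add _ _)) => //.
  by apply: lerD; apply: density_le; exact: dr.
have -> : (2 * c)^-1 * \sum_y (psi s x - psi s y) ^+ 2 * th y =
   (c * pi x)^-1 * (2^-1 * \sum_y (psi s x - psi s y) ^+ 2 * conductance Q pi (rho s) x y).
  have -> : \sum_y (psi s x - psi s y) ^+ 2 * conductance Q pi (rho s) x y =
     pi x * \sum_y (psi s x - psi s y) ^+ 2 * th y.
    by rewrite mulr_sumr; apply: eq_bigr => y _; rewrite /conductance /th; ring.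
  by field; rewrite !gt_eqF.
apply: ler_wpM2l; first by rewrite invr_ge0 mulr_ge0// ltW.
rewrite energyE ler_wpM2l ?invr_ge0 ?ler0n// [leRHS](bigD1 x)//= lerDl.
apply: sumr_ge0 => y _; apply: sumr_ge0 => z _.
by rewrite mulr_ge0 ?sqr_ge0 ?conductance_ge0.
Qed.

Let uniform_density : density pi (fun=> 1).
Proof. by split=> //; under eq_bigr do rewrite mul1r; exact: (pi_sum1 chain). Qed.

Lemma entropy_uniform : entropy pi (fun=> 1) = 0.
Proof. by rewrite /entropy big1// => x _; rewrite ln1 mulr0. Qed.

(** The speed at which a curve changes the slope functional of [r] is
    controlled by the Fisher information of [r], as long as the curve stays
    below [2 r]. *)
Lemma slope_speed_le r nu p (k : R) : (forall x, 0 < r x) ->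
  (forall x, 0 <= nu x <= 2 * r x) -> 0 < k ->
  `|\sum_x (pi x * ln (r x)) * velocity Q nu p x| <=
  k * fisher r + (2 * k)^-1 * energy Q pi nu p.
Proof.
move=> r0 nur k0; have nu0 x : 0 <= nu x by case/andP: (nur x).
have -> : \sum_x (pi x * ln (r x)) * velocity Q nu p x =
    2^-1 * \sum_x \sum_y (ln (r x) - ln (r y)) * (p x - p y) * conductance Q pi nu x y.
  rewrite -[RHS]opprK -laplacian_parts; last by move=> x y; exact: conductanceC.
  rewrite -sumrN; apply: eq_bigr => x _.
  by rewrite -mulrN -pi_velocity; ring.
rewrite normrM ger0_norm ?invr_ge0 ?ler0n// /fisher energyE.
rewrite [k * _]mulrCA [(2 * k)^-1 * _]mulrCA -mulrDr ler_wpM2l ?invr_ge0 ?ler0n//.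
apply: (le_trans (ler_norm_sum _ _ _)); rewrite !mulr_sumr -big_split/=.
apply: ler_sum => x _.
apply: (le_trans (ler_norm_sum _ _ _)); rewrite !mulr_sumr -big_split/=.
apply: ler_sum => y _.
set a := ln (r x) - ln (r y); set b := p x - p y; set w := conductance _ _ _ _ _.
have w0 : 0 <= w by exact: conductance_ge0.
have wle : a ^+ 2 * w <= 2 * (a * (r x - r y) * Q x y * pi x).
  have -> : 2 * (a * (r x - r y) * Q x y * pi x) =
      a ^+ 2 * (logmean (2 * r x) (2 * r y) * Q x y * pi x).
    rewrite logmeanZ ?ler0n ?(ltW (r0 _))//.
    by rewrite logmeanC ?(ltW (r0 _))// -(logmean_ln (r0 y) (r0 x)) -/a; ring.
  apply: ler_wpM2l; first exact: sqr_ge0.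
  apply: ler_wpM2r; first exact: ltW.
  apply: ler_wpM2r; first exact: Q0.
  exact: ler_logmean (nur x) (nur y).
rewrite normrM (ger0_norm w0) normrM.
have -> : b ^+ 2 = `|b| ^+ 2 by rewrite real_normK ?num_real.
move: wle; have -> : a ^+ 2 = `|a| ^+ 2 by rewrite real_normK ?num_real.
set T := a * _ * _ * _ => wle.
have kT : k * (`|a| ^+ 2 * w) <= 2 * (k * T) by rewrite [leRHS]mulrCA ler_wpM2l// ltW.
have sq : 2 * (`|a| * `|b| * w) <= k * (`|a| ^+ 2 * w) + k^-1 * (`|b| ^+ 2 * w).
  have -> : k * (`|a| ^+ 2 * w) + k^-1 * (`|b| ^+ 2 * w) =
     w * (k^-1 * ((k * `|a|) ^+ 2 + `|b| ^+ 2)) by field; rewrite gt_eqF.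
  have -> : 2 * (`|a| * `|b| * w) = w * (k^-1 * (2 * ((k * `|a|) * `|b|))).
    by field; rewrite gt_eqF.
  rewrite ler_wpM2l// ler_wpM2l ?invr_ge0 ?(ltW k0)//.
  by have := sqr_ge0 (k * `|a| - `|b|); lra.
have -> : (2 * k)^-1 * (`|b| ^+ 2 * w) = 2^-1 * (k^-1 * (`|b| ^+ 2 * w)).
  by rewrite invfM mulrA.
by move: kT sq; set u := k * T; lra.
Qed.

Variable D : R.
Hypothesis D0 : 0 < D.
Hypothesis diamD : (diameter Q pi <= D%:E)%E.
Hypothesis ric : Ric_ge Q pi 0.

(** Convexity along the geodesic to equilibrium bounds the entropy by its
    initial slope. As the entropy is convex for the linear structure too, that
    slope is seen by a linear functional of any cheap curve which starts like
    the geodesic. *)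
Theorem entropy_le_fisher r (m : R) : density pi r -> (forall x, 0 < r x) -> 0 < m ->
  entropy pi r <= m * fisher r + 9 * D ^+ 2 / (2 * m).
Proof.
move=> dr r0 m0.
have [g [geo g0 g1]] := exists_geodesic chain D0 diamD dr uniform_density.
have [dg gE] := geo.
have [K K0 disp] := curve_displacement.
(* an explicit positive lower bound of the density *)
pose e0 := (1 + \sum_x (r x)^-1)^-1.
have sr0 : 0 <= \sum_x (r x)^-1 by apply: sumr_ge0 => x _; rewrite invr_ge0 ltW.
have e00 : 0 < e0 by rewrite invr_gt0; lra.
have e0r x : e0 <= r x.
  rewrite -[leRHS]invrK lef_pV2 ?posrE ?invr_gt0//; last by lra.
  rewrite (bigD1 x)//= addrCA lerDl addr_ge0// sumr_ge0// => y _.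
  by rewrite invr_ge0 ltW.
(* a time so short that curves of length 3 D s from r stay below 2 r *)
pose s := Num.min 1 (e0 / (K * (3 * D))).
have KD0 : 0 < K * (3 * D) by rewrite !mulr_gt0.
have s0 : 0 < s by rewrite lt_min ltr01 divr_gt0.
have s1 : s <= 1 by rewrite ge_min lexx.
have Ks : K * (3 * D * s) <= e0.
  by rewrite mulrA [_ * s]mulrC -ler_pdivlMr// ge_min lexx orbT.
have s01 : 0 <= s <= 1 by rewrite (ltW s0).
have z01 : 0 <= (0 : R) <= 1 by rewrite lexx ler01.
have c0 : 0 < 3 * D * s by rewrite !mulr_gt0.
have [nu [phi [adm le]]] : cost_le Q pi r (g s) ((3 * D * s) ^+ 2).
  apply: (cost_le_dist chain D0 diamD) => //; first exact: dg.
  have := gE 0 s z01 s01; rewrite g0 g1 sub0r normrN (gtr0_norm s0).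
  rewrite (dist_fin chain D0 diamD dr (dg _ s01)).
  rewrite (dist_fin chain D0 diamD dr uniform_density) -EFinM => -[->].
  have := dist_le_diam chain D0 diamD dr uniform_density => h.
  rewrite mulrC ltr_pM2r//; apply: (le_lt_trans h); rewrite ltr_pM2r//.
  by rewrite ltr_nat.
have nur t : 0 <= t <= 1 -> forall x, 0 <= nu t x <= 2 * r x.
  move=> t01 x; have [dn _ _ _ _] := adm; have [n0 _] := dn t t01.
  rewrite n0/=; have := disp _ _ _ _ _ c0 adm le t x t01.
  rewrite ler_norml => /andP[_ h2]; have := e0r x.
  by move: h2 Ks; set k := K * _; lra.
(* the weight which turns the bound at time s, divided by s, into the claim *)
pose k := s * m; have k0 : 0 < k by rewrite mulr_gt0.
have fish0 : 0 <= fisher r.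
  rewrite mulr_ge0 ?invr_ge0 ?ler0n//; apply: sumr_ge0 => x _; apply: sumr_ge0 => y _.
  rewrite mulr_ge0 ?(ltW (pi0 _))// mulr_ge0//.
  have [h|/ltW h] := leP (r x) (r y).
    by rewrite mulr_le0// subr_le0// ler_ln ?posrE.
  by rewrite mulr_ge0// subr_ge0// ler_ln ?posrE.
have one01 : 0 <= (1 : R) <= 1 by rewrite ler01 lexx.
have := curve_linear_bound (l := fun x => pi x * ln (r x)) (A := k * fisher r)
  (B := (2 * k)^-1) adm le _ _ _ one01.
have -> : nu 1 = g s by have [_ _ []] := adm.
move=> bound.
have {bound} : `|\sum_x pi x * ln (r x) * g s x - \sum_x pi x * ln (r x) * r x| <=
    k * fisher r + (2 * k)^-1 * (3 * D * s) ^+ 2.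
  apply: bound.
  - by rewrite mulr_ge0// ltW.
  - by rewrite invr_ge0 mulr_ge0// ltW.
  - by move=> t t01; apply: slope_speed_le => //; exact: nur.
rewrite distrC => /(le_trans (ler_norm _)) slope.
have [_ dr1] := dr; have [dgs0 dgs1] := dg s s01.
have conv : entropy pi r - entropy pi (g s) <=
    \sum_x pi x * ln (r x) * r x - \sum_x pi x * ln (r x) * g s x.
  have -> : \sum_x pi x * ln (r x) * r x - \sum_x pi x * ln (r x) * g s x =
      \sum_x (pi x * ln (r x) * r x - pi x * ln (r x) * g s x + (r x * pi x - g s x * pi x)).
    by rewrite big_split/= !sumrB dr1 dgs1 subrr addr0.
  rewrite /entropy -sumrB; apply: ler_sum => x _.
  have := xlnx_le_tangent (r0 x) (dgs0 x) => h.
  have : pi x * (r x * ln (r x) - g s x * ln (g s x)) <=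
      pi x * (ln (r x) * (r x - g s x) + (r x - g s x)) by rewrite ler_wpM2l// ltW.
  by lra.
have : entropy pi (g s) <= (1 - s) * entropy pi r.
  have := ric geo s01.
  by rewrite g0 g1 entropy_uniform mulr0 addr0 !mul0r mul0e sube0 lee_fin.
move=> cvx.
rewrite -(ler_pM2l s0).
have -> : s * (m * fisher r + 9 * D ^+ 2 / (2 * m)) =
   k * fisher r + (2 * k)^-1 * (3 * D * s) ^+ 2.
  by rewrite /k; field; rewrite !gt_eqF.
by move: slope conv cvx; lra.
Qed.

End HWI.

(** * The spectral gap *)

Section SpectralGap.
Context {R : realType} {X : finType}.
Variables (Q : X -> X -> R) (pi : X -> R).
Hypothesis chain : reversible_chain Q pi.
Implicit Types (p q : X -> R).

Let Q0 x y : 0 <= Q x y. Proof. exact: (rate_ge0 chain). Qed.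
Let pi0 x : 0 < pi x. Proof. exact: (pi_gt0 chain). Qed.

(** The generator on plain functions instead of [{ffun X -> R^o}]. *)
Definition gen p x : R := \sum_y (p y - p x) * Q x y.

Definition dirichlet p q : R :=
  2^-1 * \sum_x \sum_y (p x - p y) * (q x - q y) * (Q x y * pi x).

Lemma leigenvalueP (l : R) :
  passmx.leigenvalue (- linfun (generator Q)) l <->
  exists p, (exists x, p x != 0) /\ forall x, - gen p x = l * p x.
Proof.
have kerE (f : {ffun X -> R^o}) : f \in passmx.leigenspace (- linfun (generator Q)) l <->
    forall x, - gen f x = l * f x.
  rewrite /passmx.leigenspace memv_ker add_lfunE opp_lfunE opp_lfunE scale_lfunE.
  rewrite id_lfunE lfunE/= subr_eq0; split.
    by move=> /eqP/ffunP h x; have := h x; rewrite !ffunE.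
  by move=> h; apply/eqP/ffunP => x; rewrite !ffunE; exact: h.
rewrite /passmx.leigenvalue -vpick0; split=> [v0|[p [[x px] pE]]].
  exists (vpick (passmx.leigenspace (- linfun (generator Q)) l)); split.
    apply: contrapT => h; move/eqP: v0; apply; apply/ffunP => x; rewrite ffunE.
    by apply/eqP; apply: contrapT => /negP vx; apply: h; exists x.
  by apply/kerE; exact: memv_pick.
rewrite vpick0; apply/eqP => E0.
have : [ffun x => p x : R^o] \in passmx.leigenspace (- linfun (generator Q)) l.
  apply/kerE => y; rewrite ffunE -pE; congr (- _).
  by apply: eq_bigr => z _; rewrite !ffunE.
rewrite E0 memv0 => /eqP/ffunP/(_ x); rewrite !ffunE => px0.
by move: px; rewrite px0 eqxx.
Qed.

Lemma dirichlet_parts p q : dirichlet p q = \sum_x pi x * (q x * - gen p x).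
Proof.
rewrite /dirichlet -[LHS]opprK.
under [X in - - (_ * X)]eq_bigr do
  under eq_bigr do rewrite [(p _ - p _) * _]mulrC.
rewrite -(@laplacian_parts _ _ (fun x y => Q x y * pi x)); last first.
  by move=> x y; exact: pi_reversible chain x y.
rewrite -sumrN; apply: eq_bigr => x _.
rewrite !mulrN mulrCA; congr (- (_ * _)); rewrite mulr_sumr; apply: eq_bigr => y _.
by ring.
Qed.

Lemma gen_mean p : \sum_x pi x * gen p x = 0.
Proof.
have := dirichlet_parts p (fun=> 1); rewrite /dirichlet big1 ?mulr0; last first.
  by move=> x _; apply: big1 => y _; rewrite subrr mulr0 mul0r.
under eq_bigr do rewrite mul1r mulrN.
by rewrite sumrN => /eqP; rewrite eq_sym oppr_eq0 => /eqP.
Qed.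

Lemma dirichlet_ge0 p : 0 <= dirichlet p p.
Proof.
rewrite mulr_ge0 ?invr_ge0 ?ler0n//; apply: sumr_ge0 => x _; apply: sumr_ge0 => y _.
apply: mulr_ge0; first by rewrite -expr2 sqr_ge0.
by rewrite mulr_ge0// ltW.
Qed.

Lemma dirichlet_lin p q t :
  dirichlet (fun x => p x + t * q x) (fun x => p x + t * q x) =
  dirichlet p p + 2 * t * dirichlet p q + t ^+ 2 * dirichlet q q.
Proof.
rewrite /dirichlet -!(mulrCA 2^-1) -!mulrDr; congr (_ * _).
rewrite !mulr_sumr -!big_split/=; apply: eq_bigr => x _.
by rewrite !mulr_sumr -!big_split/=; apply: eq_bigr => y _; ring.
Qed.

Let norm2 p : R := \sum_x pi x * p x ^+ 2.

Let norm2_ge0 p : 0 <= norm2 p.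
Proof. by apply: sumr_ge0 => x _; rewrite mulr_ge0 ?sqr_ge0// ltW. Qed.

Let norm2_eq0 p : norm2 p = 0 -> forall x, p x = 0.
Proof.
move=> /eqP; rewrite psumr_eq0 => [/allP h x|x _]; last first.
  by rewrite mulr_ge0 ?sqr_ge0// ltW.
have := h x (mem_index_enum x).
by rewrite /= mulf_eq0 gt_eqF//= sqrf_eq0 => /eqP.
Qed.

Let norm2_lin p q t : norm2 (fun x => p x + t * q x) =
  norm2 p + 2 * t * (\sum_x pi x * (p x * q x)) + t ^+ 2 * norm2 q.
Proof.
rewrite /norm2 !mulr_sumr -!big_split/=; apply: eq_bigr => x _; ring.
Qed.

(** Without energy a function is constant, by irreducibility. *)
Lemma dirichlet_eq0 p : dirichlet p p = 0 -> \sum_x pi x * p x = 0 -> forall x, p x = 0.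
Proof.
move=> /eqP; rewrite mulf_eq0 invr_eq0 pnatr_eq0/=.
have s0 x y : 0 <= (p x - p y) * (p x - p y) * (Q x y * pi x).
  apply: mulr_ge0; first by rewrite -expr2 sqr_ge0.
  by rewrite mulr_ge0// ltW.
rewrite psumr_eq0 => [/allP h m0 x|x _]; last exact: sumr_ge0.
have edge a b : 0 < Q a b -> p a = p b.
  move=> Qab; have := h a (mem_index_enum a).
  rewrite /= psumr_eq0// => /allP/(_ b (mem_index_enum b))/=.
  by rewrite !mulf_eq0 orbb (gt_eqF Qab) (gt_eqF (pi0 a)) !orbF subr_eq0 => /eqP.
have cst y : p y = p x.
  have /connectP[s + ->] := rate_irreducible chain y x.
  by elim: s y => //= z s IH y /andP[/edge -> /IH].
move: m0; under eq_bigr do rewrite cst.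
by rewrite -mulr_suml (pi_sum1 chain) mul1r.
Qed.

Let feasible p := \sum_x pi x * p x = 0 /\ norm2 p = 1.

Let normalize p : (exists x, p x != 0) -> \sum_x pi x * p x = 0 ->
  exists c, [/\ 0 < c, c ^+ 2 * norm2 p = 1 & feasible (fun x => 0 + c * p x)].
Proof.
move=> [x px] m0.
have n0 : 0 < norm2 p.
  rewrite lt_def norm2_ge0 andbT; apply/eqP => /norm2_eq0/(_ x) px0.
  by move: px; rewrite px0 eqxx.
exists (Num.sqrt (norm2 p))^-1.
have c2 : (Num.sqrt (norm2 p))^-1 ^+ 2 * norm2 p = 1.
  by rewrite exprVn sqr_sqrtr ?mulVf ?gt_eqF// ltW.
split => //; first by rewrite invr_gt0 sqrtr_gt0.
split; first by under eq_bigr do rewrite add0r mulrCA; rewrite -mulr_sumr m0 mulr0.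
by rewrite -[RHS]c2 /norm2 mulr_sumr; apply: eq_bigr => y _; rewrite add0r; ring.
Qed.

(** A minimising sequence for the Rayleigh quotient has bounded values, hence a
    limit along an ultrafilter. *)
Let minimizer : exists2 h, feasible h & forall p, feasible p -> dirichlet h h <= dirichlet p p.
Proof.
pose S := [set dirichlet p p | p in feasible].
have lbS : lbound S 0 by move=> _ [p _ <-]; exact: dirichlet_ge0.
have S0 : S !=set0.
  have /card_gt1P[a [b [_ _ ab]]] := chain_card chain.
  pose p x := (x == a)%:R / pi a - (x == b)%:R / pi b : R.
  have pa : p a != 0.
    by rewrite /p eqxx (negbTE ab) mul0r subr0 mul1r invr_eq0 gt_eqF.
  have m0 : \sum_x pi x * p x = 0.
    have D z : \sum_x pi x * ((x == z)%:R / pi z) = 1 :> R.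
      rewrite (bigD1 z)//= big1 ?addr0 => [|y /negbTE ->]; last by rewrite mul0r mulr0.
      by rewrite eqxx mul1r divff// gt_eqF.
    by under eq_bigr do rewrite mulrBr; rewrite sumrB !D subrr.
  have [c [_ _ fp]] := normalize (ex_intro _ a pa) m0.
  by eexists; eexists; [exact: fp|].
have hS : has_inf S by split => //; exists 0.
have /choice[ps psP] : forall n : nat, exists p, feasible p /\
    dirichlet p p < inf S + n.+1%:R^-1.
  move=> n; have n0 : 0 < n.+1%:R^-1 :> R by rewrite invr_gt0 ltr0n.
  by have [_ [p fp <-] lt] := inf_adherent n0 hS; exists p.
have [U [UU UN]] := @ultraFilterLemma nat \oo eventually_filter.
have UP := @ultra_proper _ _ UU.
have FU : Filter U by exact: filter_filter.
have bnd x n : 0 <= ps n x + (1 + (pi x)^-1) <= 2 * (1 + (pi x)^-1).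
  have [[_ n1] _] := psP n.
  have : ps n x ^+ 2 <= (pi x)^-1.
    rewrite -[leRHS]mul1r ler_pdivlMr// -n1 /norm2 (bigD1 x)//= mulrC lerDl.
    by apply: sumr_ge0 => y _; rewrite mulr_ge0 ?sqr_ge0// ltW.
  by set k := (pi x)^-1; move=> ?; apply/andP; split; nra.
have /choice[h hP] : forall x, exists l : R, (fun n => ps n x) @ U --> l.
  move=> x; have [l cl] := ultra_cvg_bounded UU (bnd x).
  exists (l - (1 + (pi x)^-1)).
  rewrite (_ : (fun n => ps n x) = (fun n => ps n x + (1 + (pi x)^-1) - (1 + (pi x)^-1))).
    exact: cvgB cl (cvg_cst _).
  by apply/funext => n; rewrite addrK.
have lim_const (f : nat -> R) (l c : R) : f @ U --> l -> (forall n, f n = c) -> l = c.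
  move=> fl fc; apply: (cvg_unique (@Rhausdorff R) fl).
  by rewrite (_ : f = cst c); [exact: cvg_cst|exact/funext].
have fh : feasible h.
  split.
    apply: (@lim_const (fun n => \sum_x pi x * ps n x)); last first.
      by move=> n; have [[]] := psP n.
    by apply: cvgr_sum => x; apply: cvgM; [exact: cvg_cst|exact: hP].
  apply: (@lim_const (fun n => norm2 (ps n))); last first.
    by move=> n; have [[]] := psP n.
  apply: cvgr_sum => x; apply: cvgM; first exact: cvg_cst.
  by rewrite expr2; under eq_fun do rewrite expr2; apply: cvgM; exact: hP.
exists h => // p fp.
have cE : (fun n => dirichlet (ps n) (ps n)) @ U --> dirichlet h h.
  apply: cvgM; first exact: cvg_cst.
  apply: cvgr_sum => x; apply: cvgr_sum => y.
  apply: cvgM; last exact: cvg_cst.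
  by apply: cvgM; apply: cvgB; exact: hP.
have Einf : dirichlet h h <= inf S.
  apply/ler_addgt0Pr => e e0.
  rewrite -(cvg_lim (@Rhausdorff R) cE); apply: limr_le.
    by apply/cvg_ex; exists (dirichlet h h).
  have /UN := near_infty_natSinv_lt (PosNum e0).
  apply: filterS => n /= ne; have [_ /ltW lt] := psP n.
  by apply: (le_trans lt); rewrite lerD2l ltW.
by apply: (le_trans Einf); apply: ge_inf; [exists 0|exists p].
Qed.

(** The minimiser of the Rayleigh quotient among functions of mean zero is an
    eigenfunction, and the eigenfunctions of every nonzero eigenvalue have mean
    zero. *)
Theorem spectral_gap_exists : exists2 l : R, 0 < l & is_spectral_gap Q l.
Proof.
have [h [hm hn] hmin] := minimizer.
pose l := dirichlet h h.
have poincare p : \sum_x pi x * p x = 0 -> l * norm2 p <= dirichlet p p.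
  move=> pm; have [[x px]|np] := pselect (exists x, p x != 0); last first.
    have -> : norm2 p = 0.
      rewrite /norm2 big1// => x _; have [->|px] := eqVneq (p x) 0.
        by rewrite expr0n mulr0.
      by case: np; exists x.
    by rewrite mulr0 dirichlet_ge0.
  have [c [c0 c2 fp]] := normalize (ex_intro _ x px) pm.
  have := hmin _ fp; rewrite dirichlet_lin -/l.
  have -> : dirichlet (fun=> 0) (fun=> 0) = 0.
    by rewrite /dirichlet big1 ?mulr0// => y _; apply: big1 => z _; rewrite subrr !mul0r.
  have -> : dirichlet (fun=> 0) p = 0.
    by rewrite /dirichlet big1 ?mulr0// => y _; apply: big1 => z _; rewrite subrr !mul0r.
  rewrite mulr0 !add0r => lc.
  have c20 : 0 < c ^+ 2 by rewrite exprn_gt0.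
  by rewrite -(ler_pM2l c20) mulrCA c2 mulr1.
have l0 : 0 < l.
  rewrite lt_def dirichlet_ge0 andbT; apply/eqP => /dirichlet_eq0/(_ hm) h0.
  move: hn; rewrite /norm2 big1; last by move=> x _; rewrite h0 expr0n mulr0.
  by move=> /eqP; rewrite eq_sym oner_eq0.
(* first variation in the direction of the residual *)
pose v x := - gen h x - l * h x.
have vm : \sum_x pi x * v x = 0.
  under eq_bigr do rewrite mulrBr mulrN mulrCA.
  by rewrite sumrB sumrN gen_mean -mulr_sumr hm mulr0 oppr0 addr0.
pose b := dirichlet h v - l * \sum_x pi x * (h x * v x).
have bE : b = norm2 v.
  rewrite /b dirichlet_parts mulr_sumr -sumrB; apply: eq_bigr => x _.
  by rewrite /v; ring.
have quad t : 0 <= 2 * t * b + t ^+ 2 * (dirichlet v v - l * norm2 v).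
  have : \sum_x pi x * (h x + t * v x) = 0.
    under eq_bigr do rewrite mulrDr mulrCA.
    by rewrite big_split/= -mulr_sumr hm vm mulr0 addr0.
  move=> /poincare; rewrite dirichlet_lin norm2_lin hn -/l /b.
  by move=> ?; lra.
have b0 : b = 0.
  pose a := dirichlet v v - l * norm2 v.
  have a0 : 0 <= a by rewrite subr_ge0 poincare.
  have a1 : 0 < a + 1 by rewrite ltr_wpDl.
  have a2 : 0 < a + 2 by rewrite ltr_wpDl.
  have := quad (- (b / (a + 1))); rewrite -/a.
  have -> : 2 * - (b / (a + 1)) * b + (- (b / (a + 1))) ^+ 2 * a =
    - ((b / (a + 1)) ^+ 2 * (a + 2)) by field; rewrite gt_eqF.
  rewrite oppr_ge0 => h1.
  have h2 : 0 <= (b / (a + 1)) ^+ 2 * (a + 2) by apply: mulr_ge0; [exact: sqr_ge0|exact: ltW].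
  have /eqP : (b / (a + 1)) ^+ 2 * (a + 2) = 0 by apply/eqP; rewrite eq_le h1 h2.
  rewrite mulf_eq0 sqrf_eq0 mulf_eq0 invr_eq0 (gt_eqF a1) orbF.
  by rewrite (gt_eqF a2) orbF => /eqP.
have v0 x : v x = 0 by apply: norm2_eq0; rewrite -bE.
exists l => //; split.
- apply/leigenvalueP; exists h; split.
    apply: contrapT => nh; move: hn; rewrite /norm2 big1.
      by move=> /eqP; rewrite eq_sym oner_eq0.
    move=> x _; have [->|hx] := eqVneq (h x) 0; first by rewrite expr0n mulr0.
    by case: nh; exists x.
  by move=> x; have /eqP := v0 x; rewrite subr_eq0 => /eqP.
- by rewrite gt_eqF.
move=> m /leigenvalueP[p [[x px] pE]] m0.
have pm : \sum_x pi x * p x = 0.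
  apply: (mulfI m0); rewrite mulr0 mulr_sumr.
  under eq_bigr do rewrite mulrCA -pE mulrN.
  by rewrite sumrN gen_mean oppr0.
have n0 : 0 < norm2 p.
  rewrite lt_def norm2_ge0 andbT; apply/eqP => /norm2_eq0/(_ x) px0.
  by move: px; rewrite px0 eqxx.
rewrite -(ler_pM2r n0); apply: (le_trans (poincare p pm)).
rewrite dirichlet_parts /norm2 mulr_sumr le_eqVlt; apply/orP; left; apply/eqP.
by apply: eq_bigr => y _; rewrite pE; ring.
Qed.

End SpectralGap.

(** * From entropy to eigenvalues *)

Lemma is_derive_sqr (R : realType) (t : R) :
  is_derive t 1 (fun s : R => s ^+ 2) (2 * t).
Proof.
have -> : (fun s : R => s ^+ 2) = (fun s => s * s) by apply/funext => s; rewrite expr2.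
have := is_deriveM (is_derive_id t 1) (is_derive_id t 1).
by rewrite /GRing.scale/= mulr1 -mulr2n mulr_natl.
Qed.

Section Herbst.
Context {R : realType} {X : finType}.
Variables (Q : X -> X -> R) (pi : X -> R).
Hypothesis chain : reversible_chain Q pi.

Let pi0 x : 0 < pi x. Proof. exact: (pi_gt0 chain). Qed.

Variable psi : X -> R.

Definition laplace (b : R) : R := \sum_x pi x * expR (b * psi x).

Definition gibbs (b : R) (x : X) : R := expR (b * psi x) / laplace b.

Definition gibbs_mean (b : R) : R := \sum_x pi x * (gibbs b x * psi x).

Lemma laplace_gt0 b : 0 < laplace b.
Proof.
have /card_gt1P[x [_ _]] := chain_card chain.
rewrite /laplace (bigD1 x)//= ltr_wpDr ?mulr_gt0 ?expR_gt0//.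
by apply: sumr_ge0 => y _; rewrite mulr_ge0 ?expR_ge0// ltW.
Qed.

Lemma gibbs_gt0 b x : 0 < gibbs b x.
Proof. by rewrite divr_gt0 ?expR_gt0 ?laplace_gt0. Qed.

Lemma gibbs_sum b : \sum_x gibbs b x * pi x = 1.
Proof.
rewrite /gibbs; under eq_bigr do rewrite mulrAC.
rewrite -mulr_suml; under eq_bigr do rewrite mulrC.
by rewrite divff// gt_eqF// laplace_gt0.
Qed.

Lemma gibbs_density b : density pi (gibbs b).
Proof. by split; [move=> x; rewrite ltW ?gibbs_gt0|exact: gibbs_sum]. Qed.

Lemma ln_gibbs b x : ln (gibbs b x) = b * psi x - ln (laplace b).
Proof.
by rewrite ln_div ?posrE ?expR_gt0 ?laplace_gt0// expRK.
Qed.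

Lemma entropy_gibbs b : entropy pi (gibbs b) = b * gibbs_mean b - ln (laplace b).
Proof.
rewrite /entropy -[ln (laplace b) in RHS]mulr1 -(gibbs_sum b) /gibbs_mean.
rewrite !mulr_sumr -sumrB; apply: eq_bigr => x _; rewrite ln_gibbs; ring.
Qed.

Variable l : R.
Hypothesis eigen : forall x, - gen Q psi x = l * psi x.

Lemma fisher_gibbs b : fisher Q pi (gibbs b) = b * l * gibbs_mean b.
Proof.
have -> : fisher Q pi (gibbs b) = b * dirichlet Q pi psi (gibbs b).
  rewrite /fisher /dirichlet mulrCA; congr (_ * _).
  rewrite mulr_sumr; apply: eq_bigr => x _; rewrite mulr_sumr; apply: eq_bigr => y _.
  by rewrite !ln_gibbs; ring.
rewrite (dirichlet_parts chain) -mulrA; congr (_ * _); rewrite mulr_sumr.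
by apply: eq_bigr => x _; rewrite eigen; ring.
Qed.

Hypothesis psi_le1 : forall x, `|psi x| <= 1.
Hypothesis l0 : 0 < l.

Lemma gibbs_mean_le1 b : gibbs_mean b <= 1.
Proof.
rewrite -(gibbs_sum b); apply: ler_sum => x _.
rewrite mulrCA ler_wpM2l ?(ltW (gibbs_gt0 _ _))//.
rewrite ler_piMr ?(ltW (pi0 _))//.
by have := psi_le1 x; rewrite ler_norml => /andP[].
Qed.

Lemma is_derive_laplace (t : R) : is_derive t 1 (fun s => laplace (s ^+ 2))
  (2 * t * laplace (t ^+ 2) * gibbs_mean (t ^+ 2)).
Proof.
have -> : 2 * t * laplace (t ^+ 2) * gibbs_mean (t ^+ 2) =
    \sum_x pi x * (expR (t ^+ 2 * psi x) * (2 * t * psi x)).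
  rewrite /gibbs_mean mulr_sumr; apply: eq_bigr => x _; rewrite /gibbs.
  by field; rewrite gt_eqF// laplace_gt0.
apply: is_derive_lincomb => x.
apply: (@is_derive1_comp _ expR (fun s => s ^+ 2 * psi x)).
have -> : (fun s => s ^+ 2 * psi x) = psi x \*: (fun s => s ^+ 2).
  by apply/funext => s; rewrite mulrC.
rewrite mulrC; exact: (is_deriveZ _ (is_derive_sqr t)).
Qed.

Variable K : R.

(** The logarithmic Laplace transform divided by the inverse temperature
    [t ^+ 2]; in the variable [t] its admissible growth is [K / t ^+ 2], which
    the second term compensates. *)
Definition herbst (t : R) : R := ln (laplace (t ^+ 2)) / t ^+ 2 + K / t.

Lemma is_derive_herbst (t : R) : 0 < t -> is_derive t 1 herbst
  (2 * (entropy pi (gibbs (t ^+ 2)) - K * t / 2) / t ^+ 3).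
Proof.
move=> t0; have Z0 := laplace_gt0 (t ^+ 2).
have dl : is_derive t 1 (fun s => ln (laplace (s ^+ 2)))
    ((laplace (t ^+ 2))^-1 * (2 * t * laplace (t ^+ 2) * gibbs_mean (t ^+ 2))).
  apply: (@is_derive1_comp _ (@ln R) (fun s => laplace (s ^+ 2))).
    exact: is_derive1_ln.
  exact: is_derive_laplace.
have d1 : is_derive t 1 (fun s : R => s^-1) (- t ^- 2).
  have := @is_deriveV R id t 1 1 (lt0r_neq0 t0) (is_derive_id t 1).
  by rewrite /GRing.scale/= mulr1.
have -> : herbst = (fun s => ln (laplace (s ^+ 2)) * (s^-1 * s^-1) + K * s^-1).
  by apply/funext => s; rewrite /herbst -invfM expr2.
rewrite entropy_gibbs.
have dh := is_deriveD (is_deriveM dl (is_deriveM d1 d1)) (is_deriveZ K d1).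
apply: (is_derive_eq dh).
transitivity (ln (laplace (t ^+ 2)) * (t^-1 * - t ^- 2 + t^-1 * - t ^- 2) +
  t^-1 * t^-1 * ((laplace (t ^+ 2))^-1 * (2 * t * laplace (t ^+ 2) * gibbs_mean (t ^+ 2))) +
  K * - t ^- 2); first by [].
by field; rewrite !gt_eqF.
Qed.


(** The derivative is, up to a positive factor, the excess of the entropy of the
    Gibbs density over its assumed bound. *)
Lemma herbst_nincr (t : R) : (forall s, 0 < s -> entropy pi (gibbs (s ^+ 2)) <= K * s / 2) ->
  2^-1 <= t -> herbst t <= herbst 2^-1.
Proof.
move=> hK t2; have gt0 (s : R) : 2^-1 <= s -> 0 < s.
  by apply: lt_le_trans; rewrite invr_gt0 ltr0n.
have dh s : s \in `]2^-1, +oo[ -> derivable herbst s 1 /\ (herbst^`())%classic s <= 0.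
  rewrite in_itv/= andbT => /ltW/gt0 s0; have [dv dE] := is_derive_herbst s0.
  split => //; rewrite derive1E dE.
  rewrite mulr_le0_ge0 ?invr_ge0 ?exprn_ge0 ?(ltW s0)//.
  by rewrite mulr_ge0_le0 ?ler0n// subr_le0 hK.
apply: (@ler0_derive1_nincry _ herbst 2^-1) => //.
- by move=> s /dh[].
- by move=> s /dh[].
- apply: derivable_within_continuous => s; rewrite in_itv/= andbT => /gt0 s0.
  by case: (is_derive_herbst s0).
Qed.

(** For large times the transform only sees the maximum of the function. *)
Lemma herbst_ge x (t : R) : psi x = 1 -> 0 < t -> 0 <= K ->
  1 + ln (pi x) / t ^+ 2 <= herbst t.
Proof.
move=> px t0 K0; have t20 : 0 < t ^+ 2 by rewrite exprn_gt0.
apply: (@le_trans _ _ (ln (laplace (t ^+ 2)) / t ^+ 2)); last first.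
  by rewrite /herbst lerDl divr_ge0// ltW.
have -> : 1 + ln (pi x) / t ^+ 2 = (t ^+ 2 + ln (pi x)) / t ^+ 2.
  by field; rewrite gt_eqF.
rewrite ler_pM2r ?invr_gt0//.
have -> : t ^+ 2 + ln (pi x) = ln (pi x * expR (t ^+ 2 * psi x)).
  by rewrite lnM ?posrE ?expR_gt0// expRK px mulr1 addrC.
rewrite ler_ln ?posrE ?mulr_gt0 ?expR_gt0 ?laplace_gt0//.
rewrite /laplace (bigD1 x)//= lerDl; apply: sumr_ge0 => y _.
by rewrite mulr_ge0 ?expR_ge0// ltW.
Qed.

(** As the function has mean zero, the logarithmic Laplace transform is
    quadratic near zero. *)
Lemma herbst_start : herbst 2^-1 <= 3^-1 + 2 * K.
Proof.
have m0 : \sum_x pi x * psi x = 0.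
  apply: (mulfI (lt0r_neq0 l0)); rewrite mulr0 mulr_sumr.
  under eq_bigr do rewrite mulrCA -eigen mulrN.
  by rewrite sumrN (gen_mean chain) oppr0.
have expE (u : R) : `|u| <= 4^-1 -> expR u <= 1 + u + 12^-1.
  rewrite ler_norml => /andP[u1 u2].
  have h : 1 - u <= expR (- u) by rewrite expR_ge1Dx.
  have u0 : 0 < 1 - u by lra.
  rewrite -[u in expR u]opprK expRN.
  apply: (@le_trans _ _ (1 - u)^-1); first by rewrite lef_pV2 ?posrE ?expR_gt0.
  rewrite -[leLHS]mul1r ler_pdivrMr//.
  by nra.
have Z : laplace (2^-1 ^+ 2) <= 1 + 12^-1.
  apply: (@le_trans _ _ (\sum_x pi x * (1 + 2^-1 ^+ 2 * psi x + 12^-1))).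
    apply: ler_sum => x _; rewrite ler_wpM2l ?(ltW (pi0 _))//; apply: expE.
    rewrite normrM ger0_norm ?exprn_ge0 ?invr_ge0 ?ler0n//.
    have -> : 2^-1 ^+ 2 = 4^-1 :> R by field.
    by rewrite ler_piMr ?invr_ge0 ?ler0n.
  have -> : \sum_x pi x * (1 + 2^-1 ^+ 2 * psi x + 12^-1) =
      (1 + 12^-1) * \sum_x pi x + 2^-1 ^+ 2 * \sum_x pi x * psi x.
    by rewrite !mulr_sumr -big_split/=; apply: eq_bigr => x _; ring.
  by rewrite m0 (pi_sum1 chain) mulr0 addr0 mulr1.
have lnZ : ln (laplace (2^-1 ^+ 2)) <= 12^-1.
  have d0 : 0 < 1 + 12^-1 :> R by lra.
  apply: (@le_trans _ _ (ln (1 + 12^-1))).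
    by rewrite ler_ln ?posrE ?laplace_gt0.
  by apply: le_ln1Dx; lra.
rewrite /herbst invrK [K * 2]mulrC lerD2r.
rewrite -[leRHS](_ : 12^-1 / 2^-1 ^+ 2 = 3^-1); last by field.
by rewrite ler_wpM2r// invr_ge0 exprn_ge0// invr_ge0 ler0n.
Qed.

End Herbst.

(** If the eigenvalue were smaller, the entropy of the Gibbs densities of the
    eigenfunction would grow so slowly that the logarithmic Laplace transform
    could not reach the maximum of the eigenfunction. *)
Theorem eigenvalue_ge (R : realType) (X : finType) (Q : X -> X -> R) (pi : X -> R)
    (D l : R) : reversible_chain Q pi -> 0 < D -> (diameter Q pi <= D%:E)%E ->
  Ric_ge Q pi 0 -> 0 < l ->
  (exists p : X -> R, (exists x, p x != 0) /\ forall x, - gen Q p x = l * p x) ->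
  1152^-1 / D ^+ 2 <= l.
Proof.
move=> chain D0 diamD ric l0 [p [[a pa] pE]].
have [x0 /= _ x0max] := @arg_maxP _ _ X a predT (fun x => `|p x|) isT.
have px0 : p x0 != 0.
  by rewrite -normr_gt0 (lt_le_trans _ (x0max a isT))// normr_gt0.
pose psi x := p x / p x0.
have psi1 : psi x0 = 1 by rewrite /psi divff.
have psi_le1 x : `|psi x| <= 1.
  by rewrite normrM normfV ler_pdivrMr ?normr_gt0// mul1r x0max.
have eigen x : - gen Q psi x = l * psi x.
  rewrite /psi mulrA -pE mulNr; congr (- _); rewrite /gen mulr_suml.
  by apply: eq_bigr => y _; ring.
have D20 : 0 < D ^+ 2 by rewrite exprn_gt0.
rewrite leNgt; apply/negP; rewrite ltr_pdivlMr// => lD.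
(* K is 144 l D^2 + 1/8, less than 1/4 for the eigenvalue to be excluded *)
pose k := 72 * D ^+ 2; have k0 : 0 < k by rewrite mulr_gt0.
pose K := 2 * k * l + 9 * D ^+ 2 / k.
have K4 : K < 4^-1.
  have -> : K = 144 * (l * D ^+ 2) + 8^-1 by rewrite /K /k; field; rewrite gt_eqF.
  by lra.
have K0 : 0 <= K.
  apply: addr_ge0; first by rewrite 2?mulr_ge0 ?ler0n ?(ltW k0) ?(ltW l0).
  by rewrite divr_ge0 ?(ltW k0)// mulr_ge0 ?ler0n ?(ltW D20).
have entK s : 0 < s -> entropy pi (gibbs pi psi (s ^+ 2)) <= K * s / 2.
  move=> s0; have m0 : 0 < k / s by rewrite divr_gt0.
  have := entropy_le_fisher chain D0 diamD ric
    (gibbs_density chain psi (s ^+ 2)) (gibbs_gt0 chain psi (s ^+ 2)) m0.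
  move=> /le_trans; apply.
  rewrite (fisher_gibbs chain eigen).
  have -> : K * s / 2 = k / s * (s ^+ 2 * l) + 9 * D ^+ 2 / (2 * (k / s)).
    by rewrite /K; field; rewrite !gt_eqF.
  rewrite lerD2r ler_wpM2l ?(ltW m0)//.
  rewrite -[leRHS]mulr1 ler_wpM2l ?mulr_ge0 ?exprn_ge0 ?(ltW s0) ?(ltW l0)//.
  exact: (gibbs_mean_le1 chain psi_le1).
(* late enough for the transform to be at least 5/6 *)
pose t := 1 + 6 * `|ln (pi x0)|.
have t1 : 1 <= t by rewrite lerDl mulr_ge0.
have t0 : 0 < t by apply: lt_le_trans t1.
have t2 : 2^-1 <= t by apply: le_trans t1; lra.
have := herbst_nincr chain entK t2.
have := herbst_ge chain psi1 t0 K0.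
have := herbst_start chain eigen psi_le1 l0 K.
have : - 6^-1 < ln (pi x0) / t ^+ 2.
  rewrite ltr_pdivlMr ?exprn_gt0//.
  have : - ln (pi x0) <= `|ln (pi x0)| by rewrite -normrN ler_norm.
  by rewrite /t; have := normr_ge0 (ln (pi x0)); set n := `|_|; nra.
by lra.
Qed.

Theorem theorem1p2 (R : realType) :
  exists c : R, 0 < c /\
    forall (X : finType) (Q : X -> X -> R) (pi : X -> R) (D : R),
      reversible_chain Q pi ->
      0 < D ->
      Ric_ge Q pi 0 ->
      (diameter Q pi <= D%:E)%E ->
      exists lambda1 : R, is_spectral_gap Q lambda1 /\ c / D ^+ 2 <= lambda1.
Proof.
exists 1152^-1; split; first by rewrite invr_gt0 ltr0n.
move=> X Q pi D chain D0 ric diamD.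
have [l l0 gapl] := spectral_gap_exists chain.
exists l; split => //; apply: (eigenvalue_ge chain D0 diamD ric l0).
by case: gapl => /leigenvalueP.
Qed.
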